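(* Let $p$ be a prime and $n$ a positive integer. Set $t=\lfloor \frac{n}{p}\rfloor-1$. Then (1) $\dim(\Delta\mathcal A_p(S_n))=\dim(\mathsf C_p(n))=t$, and (2) $\widetilde H_j(\Delta\mathcal A_p(S_n))\cong_{S_n}\widetilde H_j(\mathsf C_p(n))$ for all $j\ge t-(p-3)$.
   Context: $\mathcal A_p(S_n)$ is the poset, ordered by inclusion, of all nontrivial elementary abelian $p$-subgroups of the symmetric group $S_n$; $\Delta\mathcal A_p(S_n)$ (the Quillen complex) is its order complex, i.e. the simplicial complex whose faces are the finite chains of the poset. The $p$-cycle complex $\mathsf C_p(n)$ is the simplicial complex with one vertex for each subgroup of $S_n$ generated by a $p$-cycle, a collection of vertices being a face if and only if the subgroups together generate an abelian group. $S_n$ acts on both complexes by conjugation of subgroups. $\widetilde H_j$ denotes reduced simplicial homology with complex coefficients, a $\mathbb C[S_n]$-module via the induced action, and $\cong_{S_n}$ denotes isomorphism of $\mathbb C[S_n]$-modules. The complex whose only face is the empty face has dimension $-1$ and has $\widetilde H_{-1}=\mathbb C$. *)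

(* Defs.v *)
From HB Require Import structures.
From mathcomp Require Import all_boot all_order all_algebra all_fingroup.
From mathcomp Require Import all_solvable all_field all_character.

Set Implicit Arguments.
Unset Strict Implicit.
Unset Printing Implicit Defensive.

Import GroupScope GRing.Theory.

(* Finite simplicial complexes with a group action by simplicial maps. The
   empty face always belongs to the complex. *)
Record simplicial_complex (aT : finGroupType) (T : finType)
    (to : {action aT &-> T}) := SimplicialComplex {
  faces :> {set {set T}};
  faces_set0 : set0 \in faces;
  faces_sub : forall A B : {set T}, A \subset B -> B \in faces -> A \in faces;
  faces_act : forall (A : {set T}) (a : aT),
    A \in faces -> (to^*)%act A a \in faces
}.

Section Homology.

Variables (F : fieldType) (aT : finGroupType) (T : finType).
Variables (to : {action aT &-> T}) (K : simplicial_complex to).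

Local Open Scope ring_scope.

Definition dimension : int := (\max_(A in faces K) #|A|)%:Z - 1.

(* Chains are graded below by the number k of vertices, so k corresponds to
   dimension k - 1. An oriented chain is a function on ordered k-tuples of
   vertices which is alternating under reordering and vanishes on the tuples
   that do not list a face without repetition: its value at (v_1, ..., v_k) is
   the coefficient of the oriented simplex [v_1, ..., v_k]. Functions on
   k-tuples are row vectors indexed by enum_rank. *)
Local Notation ntuples k := #|{: k.-tuple T}|.

Definition ordered_simplex k (s : k.-tuple T) : bool :=
  uniq s && ([set x in s] \in faces K).

(* Row s is the oriented simplex [s], seen as an alternating function. *)
Definition chains k : 'M[F]_(ntuples k) :=
  \matrix_(i, j)
    (if ordered_simplex (enum_val i) then
       \sum_(u : 'S_k) (-1) ^+ u *
         ([tuple tnth (enum_val i) (u l) | l < k] == enum_val j)%:R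
     else 0).

(* (boundary c)(t) = \sum_v c(v :: t). On alternating functions this is the
   usual \sum_i (-1)^i [v_0, .., omit v_i, .., v_m], since moving v_i to the
   front is a permutation of sign (-1)^i. It includes the augmentation (k = 1),
   and it is 0 for k = 0. *)
Definition boundary k : 'M[F]_(ntuples k, ntuples k.-1) :=
  \matrix_(i, j) ((0 < k)%N && (behead_tuple (enum_val i) == enum_val j))%:R.

Definition cycles k : 'M[F]_(ntuples k) := (chains k :&: kermx (boundary k))%MS.

Definition boundaries k : 'M[F]_(ntuples k) :=
  <<chains k.+1 *m boundary k.+1>>%MS.

Definition tuple_mx k (a : aT) : 'M[F]_(ntuples k) :=
  \matrix_(i, j) (map_tuple (to^~ a) (enum_val i) == enum_val j)%:R.

Lemma row_tuple_mx k a (s : k.-tuple T) :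
  row (enum_rank s) (tuple_mx k a) = delta_mx 0 (enum_rank (map_tuple (to^~ a) s)).
Proof.
apply/rowP=> j; rewrite !mxE eqxx enum_rankK /=.
by rewrite -(inj_eq enum_rank_inj) enum_valK eq_sym.
Qed.

Lemma tuple_mx_repr k : mx_repr [set: aT] (tuple_mx k).
Proof.
split=> [|a b _ _]; apply/row_matrixP=> i; rewrite -(enum_valK i).
  rewrite row_tuple_mx row1; congr (delta_mx _ (enum_rank _)).
  by apply: val_inj; rewrite /= -[RHS]map_id; apply: eq_map => x; rewrite act1.
rewrite row_mul !row_tuple_mx -rowE row_tuple_mx.
congr (delta_mx _ (enum_rank _)); apply: val_inj => /=.
by rewrite -map_comp; apply: eq_map => x /=; rewrite actM.
Qed.

Definition tuple_repr k : mx_representation F [set: aT] (ntuples k) :=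
  MxRepresentation (tuple_mx_repr k).

Lemma ordered_simplex_act k (s : k.-tuple T) a :
  ordered_simplex s -> ordered_simplex (map_tuple (to^~ a) s).
Proof.
case/andP=> Us Ks; apply/andP; split; first by rewrite map_inj_uniq //; apply: act_inj.
have -> : [set x in map_tuple (to^~ a) s] = (to^*)%act [set x in s] a.
  apply/setP=> y; rewrite inE; apply/mapP/imsetP => [] [x sx ->];
    by exists x; rewrite ?inE // in sx *.
exact: faces_act.
Qed.

Lemma row_chains k (s : k.-tuple T) :
  row (enum_rank s) (chains k) =
  if ordered_simplex s then
    \sum_(u : 'S_k) (-1) ^+ u *:
      delta_mx 0 (enum_rank [tuple tnth s (u l) | l < k])
  else 0.
Proof.
apply/rowP=> j; rewrite !mxE enum_rankK; case: ifP => _; last by rewrite mxE.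
rewrite summxE; apply: eq_bigr => u _; rewrite !mxE eqxx /=.
by rewrite -(inj_eq enum_rank_inj) enum_valK eq_sym.
Qed.

Lemma chains_module k : mxmodule (tuple_repr k) (chains k).
Proof.
apply/mxmoduleP=> a _; apply/row_subP=> i; rewrite -(enum_valK i) row_mul row_chains.
set s := enum_val i; case: ifP => [Ks | _]; last by rewrite mul0mx sub0mx.
suff -> : (\sum_(u : 'S_k) (-1) ^+ u *:
      delta_mx 0 (enum_rank [tuple tnth s (u l) | l < k])) *m tuple_repr k a
   = row (enum_rank (map_tuple (to^~ a) s)) (chains k) by apply: row_sub.
rewrite row_chains ordered_simplex_act // mulmx_suml.
apply: eq_bigr => u _; rewrite -scalemxAl -rowE row_tuple_mx.
congr (_ *: delta_mx _ (enum_rank _)); apply: eq_from_tnth => l.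
by rewrite !tnth_map !tnth_ord_tuple.
Qed.

Lemma row_boundary k (s : k.+1.-tuple T) :
  row (enum_rank s) (boundary k.+1) = delta_mx 0 (enum_rank (behead_tuple s)).
Proof.
apply/rowP=> j; rewrite !mxE eqxx enum_rankK /=.
by rewrite -(inj_eq enum_rank_inj) enum_valK eq_sym.
Qed.

Lemma boundary_act k a :
  tuple_repr k a *m boundary k = boundary k *m tuple_repr k.-1 a.
Proof.
case: k => [|k].
  have -> : boundary 0 = 0 by apply/matrixP=> i j; rewrite !mxE.
  by rewrite mulmx0 mul0mx.
apply/row_matrixP=> i; rewrite -(enum_valK i) !row_mul row_tuple_mx -rowE.
rewrite !row_boundary -rowE row_tuple_mx.
congr (delta_mx _ (enum_rank _)); apply: val_inj => /=.
by rewrite behead_map.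
Qed.

Lemma cycles_module k : mxmodule (tuple_repr k) (cycles k).
Proof.
apply/mxmoduleP=> a Ga; rewrite sub_capmx (mxmodule_trans (chains_module k)) ?capmxSl //.
apply/sub_kermxP; rewrite -mulmxA boundary_act mulmxA.
by rewrite (sub_kermxP (capmxSr _ _)) mul0mx.
Qed.

Lemma boundaries_module k : mxmodule (tuple_repr k) (boundaries k).
Proof.
rewrite (eqmx_module _ (genmxE _)); apply/mxmoduleP=> a Ga.
rewrite -mulmxA -[tuple_repr k a]/(tuple_repr k.+1.-1 a) -boundary_act mulmxA.
by rewrite submxMr // (mxmoduleP (chains_module _)).
Qed.

(* The reduced homology in dimension j : int, as a packaged representation;
   grepr0 is the zero module. For j + 1 = k it is the subquotient
   cycles k / boundaries k of the permutation module on k-tuples. Matrices act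
   on row vectors on the right, which matches the convention that a * b is
   "a, then b" in a permutation group. *)
Definition reduced_homology (j : int) : representation F [set: aT] :=
  match j + 1 with
  | Posz k => Representation
                (section_repr (boundaries_module k) (cycles_module k))
  | Negz _ => grepr0
  end.

End Homology.

Section Complexes.

Variables p n : nat.

Definition is_p_cycle (s : 'S_n) : bool :=
  [exists x, (#|porbit s x| == p) && perm_on (porbit s x) s].

(* Vertex set of the Quillen complex: the nontrivial elementary abelian
   p-subgroups of S_n. *)
Definition elementary_abelian_subgroups : {set {group 'S_n}} :=
  [set E : {group 'S_n} | p.-abelem E & E :!=: 1].

Definition p_cycle_subgroups : {set {group 'S_n}} :=
  [set <[s]>%G | s : 'S_n & is_p_cycle s].

Definition quillen_faces : {set {set {group 'S_n}}} :=
  [set A : {set {group 'S_n}} | (A \subset elementary_abelian_subgroups) &&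
     [forall E in A, forall E' in A, (E \subset E') || (E' \subset E)]].

Definition p_cycle_faces : {set {set {group 'S_n}}} :=
  [set A : {set {group 'S_n}} | (A \subset p_cycle_subgroups) &&
     abelian <<\bigcup_(P in A) P>>].

Lemma quillen_faces_set0 : set0 \in quillen_faces.
Proof. by rewrite inE sub0set; apply/forall_inP=> E; rewrite inE. Qed.

Lemma quillen_faces_sub (A B : {set {group 'S_n}}) :
  A \subset B -> B \in quillen_faces -> A \in quillen_faces.
Proof.
move=> sAB; rewrite !inE => /andP[sB cB]; rewrite (subset_trans sAB) //=.
apply/forall_inP=> E AE; apply/forall_inP=> E' AE'.
by apply: (forall_inP (forall_inP cB E _) E'); apply: (subsetP sAB).
Qed.

Lemma quillen_faces_act (A : {set {group 'S_n}}) (a : 'S_n) :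
  A \in quillen_faces -> ('JG^*)%act A a \in quillen_faces.
Proof.
rewrite !inE => /andP[sA cA]; apply/andP; split.
  apply/subsetP=> _ /imsetP[E AE ->]; have:= subsetP sA E AE; rewrite !inE /=.
  by rewrite abelemJ -(inj_eq (@conjsg_inj _ a) E) conjs1g.
apply/forall_inP=> _ /imsetP[E AE ->]; apply/forall_inP=> _ /imsetP[E' AE' ->].
by rewrite /= !conjSg; apply: (forall_inP (forall_inP cA E _) E').
Qed.

Definition quillen_complex : simplicial_complex (@conjG_action 'S_n) :=
  SimplicialComplex quillen_faces_set0 quillen_faces_sub quillen_faces_act.

Lemma p_cycle_faces_set0 : set0 \in p_cycle_faces.
Proof. by rewrite inE sub0set big_set0 gen0 abelian1. Qed.

Lemma p_cycle_faces_sub (A B : {set {group 'S_n}}) :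
  A \subset B -> B \in p_cycle_faces -> A \in p_cycle_faces.
Proof.
move=> sAB; rewrite !inE => /andP[sB cB]; rewrite (subset_trans sAB) //=.
apply: abelianS cB; apply: genS; apply/bigcupsP=> P AP.
by apply: bigcup_sup; apply: (subsetP sAB).
Qed.

Lemma is_p_cycleJ (s a : 'S_n) : is_p_cycle s -> is_p_cycle (s ^ a).
Proof.
case/existsP=> x /andP[/eqP cx ox]; apply/existsP; exists (a x).
have Eo y : (a y \in porbit (s ^ a) (a x)) = (y \in porbit s x).
  apply/porbitP/porbitP => [] [m E]; exists m.
    by apply: (@perm_inj _ a); rewrite E -conjXg permJ.
  by rewrite E -conjXg permJ.
have -> : porbit (s ^ a) (a x) = a @: porbit s x.
  apply/setP=> y; rewrite -[y](permKV a) Eo mem_imset //; exact: perm_inj.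
rewrite card_imset ?cx ?eqxx /=; last exact: perm_inj.
apply/subsetP=> y; rewrite -[y](permKV a) inE permJ (inj_eq perm_inj) => ny.
by rewrite mem_imset; [apply: (subsetP ox) | apply: perm_inj].
Qed.

Lemma p_cycle_faces_act (A : {set {group 'S_n}}) (a : 'S_n) :
  A \in p_cycle_faces -> ('JG^*)%act A a \in p_cycle_faces.
Proof.
rewrite !inE => /andP[sA cA]; apply/andP; split.
  apply/subsetP=> _ /imsetP[E AE ->].
  have /imsetP[s] := subsetP sA E AE; rewrite inE => cs ->.
  apply/imsetP; exists (s ^ a); first by rewrite inE is_p_cycleJ.
  by apply: val_inj; rewrite /= cycleJ.
rewrite -(abelianJ _ a) -genJ in cA; apply: abelianS cA.
apply: genS; apply/bigcupsP=> _ /imsetP[E AE ->] /=.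
by rewrite conjSg (bigcup_sup E).
Qed.

Definition p_cycle_complex : simplicial_complex (@conjG_action 'S_n) :=
  SimplicialComplex p_cycle_faces_set0 p_cycle_faces_sub p_cycle_faces_act.

End Complexes.

(* Main.v *)
Require Import Defs.
From mathcomp Require Import all_boot all_order all_algebra all_fingroup.
From mathcomp Require Import all_solvable all_field all_character.
From mathcomp Require Import reals.
From mathcomp Require Import complex.
From mathcomp Require Import ring zify.

(* A chain of elementary abelian p-subgroups whose largest term E has an orbit
   of size greater than p is short: the rank of E is at most n/p - p + 2. So in
   the degrees of the statement only the groups all of whose orbits have size at
   most p matter. To such a group E associate the set sigma(E) of the subgroups
   generated by the p-cycles that elements of E induce on its nontrivial orbits;
   sigma(E) is a nonempty face of the p-cycle complex and is monotone in E.
   Sending the vertex E to the barycenter of sigma(E), and extending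
   multilinearly to simplices, gives an equivariant chain map phi from the
   Quillen complex to the p-cycle complex.
   Let sd send a tuple of groups to the signed sum of the flags of subgroups
   generated by its reorderings. On p-cycle simplices phi o sd is a nonzero
   scalar, so phi is surjective in homology. Injectivity: in the complex of sets
   of groups that generate an elementary abelian group with orbits of size at
   most p, a prism shows that a cycle z of the Quillen complex is homologous to
   phi(z), and sd maps this complex to the Quillen complex, restricting to the
   identity on chains of groups.
   All operators act on cochains, that is, on functions on sequences of vertices;
   chains are recovered by duality, as row vectors paired with cochains. *)

Set Implicit Arguments.
Unset Strict Implicit.
Unset Printing Implicit Defensive.

Import GroupScope GRing.Theory Num.Theory.

(** * Operators on cochains *)

Section Cochains.

Local Open Scope ring_scope.

Variables (F : fieldType) (T : finType).

Implicit Types (c g : seq T -> F) (s t : seq T).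

(* The transpose of the boundary of Defs.v, which deletes the first vertex. The
   transpose codiff of the alternating sum of all deletions is related to it by
   antisymmetrization, see alts_cobound. *)
Definition cobound c s : F := if s is _ :: s' then c s' else 0.

Fixpoint codiff c s : F :=
  if s is x :: s' then c s' - codiff (fun t => c (x :: t)) s' else 0.

Lemma eq_codiff c g s :
  (forall t, subseq t s -> (size t).+1 = size s -> c t = g t) ->
  codiff c s = codiff g s.
Proof.
elim: s c g => //= x s IHs c g eqcg; congr (_ - _).
  by apply: eqcg => //; apply: subseq_cons.
by apply: IHs => t st szt; apply: eqcg; rewrite /= ?eqxx ?szt.
Qed.

Lemma codiff_sum (I : Type) (r : seq I) (a : I -> F) (c : I -> seq T -> F) s :
  codiff (fun t => \sum_(i <- r) a i * c i t) s = \sum_(i <- r) a i * codiff (c i) s.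
Proof.
elim: s c => [|x s IHs] c /=; first by rewrite big1 // => i _; rewrite mulr0.
by rewrite IHs -sumrB; apply: eq_bigr => i _; rewrite mulrBr.
Qed.

Lemma codiffB c g s : codiff (fun t => c t - g t) s = codiff c s - codiff g s.
Proof.
elim: s c g => [|x s IHs] c g /=; first by rewrite subr0.
by rewrite IHs; ring.
Qed.

Section Tensor.

Variable A : T -> T -> F.

(* The transpose of v_1 ... v_k |-> A(v_1) ... A(v_k), extended multilinearly,
   where A(x) = \sum_y A x y * y. *)
Fixpoint tens c s : F :=
  if s is x :: s' then \sum_y A x y * tens (fun t => c (y :: t)) s' else c [::].

Lemma eq_tens c g s :
  (forall t, size t = size s ->
     (forall y, y \in t -> exists2 x, x \in s & A x y != 0) -> c t = g t) ->
  tens c s = tens g s.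
Proof.
elim: s c g => [|x s IHs] c g eqcg /=; first exact: eqcg.
apply: eq_bigr => y _; have [-> | nz] := eqVneq (A x y) 0; first by rewrite !mul0r.
congr (_ * _); apply: IHs => t szt At; apply: eqcg; first by rewrite /= szt.
move=> z; rewrite inE => /orP[/eqP-> | tz]; first by exists x; rewrite ?mem_head.
by have [w sw Aw] := At z tz; exists w; rewrite // inE sw orbT.
Qed.

Lemma tens0 s : tens (fun=> 0) s = 0.
Proof.
by elim: s => //= x s IHs; rewrite big1 // => y _; rewrite IHs mulr0.
Qed.

Lemma tensB c g s : tens (fun t => c t - g t) s = tens c s - tens g s.
Proof.
elim: s c g => [|x s IHs] c g //=; rewrite -sumrB; apply: eq_bigr => y _.
by rewrite IHs mulrBr.
Qed.

Lemma tens_tuple k c (s : k.-tuple T) :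
  tens c s = \sum_(t : k.-tuple T) (\prod_(i < k) A (tnth s i) (tnth t i)) * c t.
Proof.
elim: k c s => [|k IHk] c s.
  rewrite (big_pred1 [tuple]) => [|t]; last by apply/esym/eqP; rewrite [t]tuple0.
  by rewrite [s]tuple0 big_ord0 mul1r.
case/tupleP: s => x s /=.
rewrite (reindex (fun yt : T * k.-tuple T => [tuple of yt.1 :: yt.2])) /=; last first.
  exists (fun t : k.+1.-tuple T => (thead t, [tuple of behead t])) => [[y t]|t] _ /=.
    by rewrite theadE; congr (_, _); apply: val_inj.
  by rewrite -tuple_eta.
rewrite -(pair_bigA _ (fun y (t : k.-tuple T) =>
  (\prod_(i < k.+1) A (tnth [tuple of x :: s] i) (tnth [tuple of y :: t] i)) * c (y :: t))).
apply: eq_bigr => y _; rewrite IHk mulr_sumr; apply: eq_bigr => t _.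
rewrite big_ord_recl !tnth0 mulrA; congr (_ * _ * _).
by apply: eq_bigr => i _; rewrite !tnthS.
Qed.

Hypothesis A1 : forall x, \sum_y A x y = 1.

Lemma tens_cobound c s : tens (cobound c) s = cobound (tens c) s.
Proof. by case: s => //= x s; rewrite -mulr_suml A1 mul1r. Qed.

Lemma tens_codiff c s : tens (codiff c) s = codiff (tens c) s.
Proof.
elim: s c => //= x s IHs c.
rewrite codiff_sum -[X in _ = X - _]mul1r -(A1 x) mulr_suml -sumrB.
by apply: eq_bigr => y _; rewrite tensB IHs mulrBr.
Qed.

(* The transpose of v_0 ... v_k |-> \sum_i (-1)^i v_0 ... v_i A(v_i) ... A(v_k) *)
Fixpoint prism c s : F :=
  if s is x :: s' then
    tens (fun t => c (x :: t)) (x :: s') - prism (fun t => c (x :: t)) s'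
  else 0.

Lemma eq_prism c g s :
  (forall t, size t = (size s).+1 ->
     (forall y, y \in t -> y \in s \/ exists2 x, x \in s & A x y != 0) ->
     c t = g t) -> prism c s = prism g s.
Proof.
elim: s c g => // x s IHs c g eqcg; rewrite /prism -/prism; congr (_ - _).
  apply: eq_tens => t szt At; apply: eqcg; first by rewrite /= szt.
  by move=> y; rewrite inE => /orP[/eqP-> | /At]; [left; rewrite mem_head | right].
apply: IHs => t szt At; apply: eqcg; first by rewrite /= szt.
move=> y; rewrite inE => /orP[/eqP-> | /At]; first by left; rewrite mem_head.
by case=> [sy | [z sz Az]]; [left | right; exists z]; rewrite // inE ?sy ?sz orbT.
Qed.

Lemma prismB c g s : prism (fun t => c t - g t) s = prism c s - prism g s.
Proof.
elim: s c g => [|x s IHs] c g; first by rewrite /= subr0.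
rewrite /prism -/prism (tensB (fun t => c (x :: t)) (fun t => g (x :: t))) IHs.
by ring.
Qed.

Lemma prism0 s : prism (fun=> 0) s = 0.
Proof.
by elim: s => // x s IHs; rewrite /prism -/prism tens0 IHs subrr.
Qed.

Lemma prism_homotopy c s :
  prism (codiff c) s + codiff (prism c) s = tens c s - c s.
Proof.
elim: s c => [|x s IHs] c; first by rewrite /= addr0 subrr.
pose cx t := c (x :: t).
have -> : prism (codiff c) (x :: s) =
    tens c (x :: s) - tens (codiff cx) (x :: s) - (prism c s - prism (codiff cx) s).
  by rewrite -prismB -tensB.
have -> : codiff (prism c) (x :: s) =
    prism c s - (codiff (fun t => tens cx (x :: t)) s - codiff (prism cx) s).
  by rewrite -codiffB.
rewrite tens_codiff.
have -> : codiff (tens cx) (x :: s) = tens cx s - codiff (fun t => tens cx (x :: t)) s by [].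
have /(canRL (addrK _)) -> := IHs cx; rewrite -/(cx s).
by ring.
Qed.

End Tensor.
End Cochains.

Section Alternation.

Local Open Scope ring_scope.

Variables (F : numFieldType) (T : finType).

Implicit Types (c g : seq T -> F).

Definition tuple_perm k (s : k.-tuple T) (u : 'S_k) : k.-tuple T :=
  [tuple tnth s (u l) | l < k].

Definition alts c (s : seq T) : F :=
  \sum_(u : 'S_(size s)) (-1) ^+ u * c (tuple_perm (in_tuple s) u).

Lemma altsE k c (s : k.-tuple T) :
  alts c s = \sum_(u : 'S_k) (-1) ^+ u * c (tuple_perm s u).
Proof.
case: s => s sz; have/eqP def_k := sz; rewrite /alts /=; subst k.
by apply: eq_bigr => u _; congr (_ * c (tval (tuple_perm _ u))); apply: val_inj.
Qed.

Lemma tuple_permM k (s : k.-tuple T) u v :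
  tuple_perm (tuple_perm s u) v = tuple_perm s (v * u)%g.
Proof. by apply: eq_from_tnth => l; rewrite !tnth_mktuple permM. Qed.

Lemma tuple_perm1 k (s : k.-tuple T) : tuple_perm s 1%g = s.
Proof. by apply: eq_from_tnth => l; rewrite !tnth_mktuple perm1. Qed.

Lemma perm_tuple_perm k (s : k.-tuple T) u : perm_eq (tuple_perm s u) s.
Proof. by apply/tuple_permP; exists u. Qed.

Lemma alts_perm k c (s : k.-tuple T) v :
  alts c (tuple_perm s v) = (-1) ^+ v * alts c s.
Proof.
rewrite !altsE mulr_sumr (reindex_inj (mulIg v^-1%g)); apply: eq_bigr => u _.
by rewrite tuple_permM mulgKV odd_permM odd_permV signr_addb mulrA [_ ^+ v * _]mulrC.
Qed.

Lemma eq_alts c g (s : seq T) :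
  (forall t, perm_eq t s -> c t = g t) -> alts c s = alts g s.
Proof.
by move=> eqcg; apply: eq_bigr => u _; rewrite eqcg //; apply: perm_tuple_perm.
Qed.

Lemma alts0 c (s : seq T) : (forall t, perm_eq t s -> c t = 0) -> alts c s = 0.
Proof. by move=> c0; apply: big1 => u _; rewrite c0 ?mulr0 ?perm_tuple_perm. Qed.

Lemma altsB c g (s : seq T) : alts (fun t => c t - g t) s = alts c s - alts g s.
Proof. by rewrite /alts -sumrB; apply: eq_bigr => u _; rewrite mulrBr. Qed.

Lemma alts_sum (I : Type) (r : seq I) (a : I -> F) (c : I -> seq T -> F) s :
  alts (fun t => \sum_(i <- r) a i * c i t) s = \sum_(i <- r) a i * alts (c i) s.
Proof.
rewrite /alts; under eq_bigr do rewrite mulr_sumr.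
rewrite exchange_big; apply: eq_bigr => i _; rewrite mulr_sumr.
by apply: eq_bigr => u _; rewrite mulrCA.
Qed.

Lemma alts_tperm_inv k g (s : k.-tuple T) i j : i != j ->
    (forall t : k.-tuple T, perm_eq t s -> g (tuple_perm t (tperm i j)) = g t) ->
  alts g s = 0.
Proof.
move=> neq_ij g_inv; apply/eqP; rewrite -eqNr; apply/eqP.
rewrite altsE [in RHS](reindex_inj (mulgI (tperm i j))) -sumrN.
apply: eq_bigr => u _; rewrite odd_permM odd_tperm neq_ij signr_addb expr1.
by rewrite -tuple_permM g_inv ?perm_tuple_perm // mulN1r mulNr.
Qed.

Lemma alts_nonuniq c (s : seq T) : ~~ uniq s -> alts c s = 0.
Proof.
move=> nUs; have /injectivePn[i [j neq_ij eq_ij]] : ~~ injectiveb (tnth (in_tuple s)).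
  by apply: contra nUs => /injectiveP; apply: (introT (tuple_uniqP (in_tuple s))).
apply/eqP; rewrite -eqNr -mulN1r; apply/eqP.
have def_s : tuple_perm (in_tuple s) (tperm i j) = in_tuple s.
  apply: eq_from_tnth => l; rewrite tnth_mktuple; case: tpermP => [->|->|//].
    by rewrite eq_ij.
  by rewrite eq_ij.
have := alts_perm c (in_tuple s) (tperm i j); rewrite def_s odd_tperm neq_ij /=.
by move=> <-.
Qed.

Lemma alts_alts c (s : seq T) : alts (alts c) s = (size s)`!%:R * alts c s.
Proof.
transitivity (\sum_(u : 'S_(size s)) alts c s).
  by apply: eq_bigr => u _; rewrite alts_perm mulrA -expr2 sqrr_sign mul1r.
by rewrite sumr_const mulr_natl; congr (_ *+ _); rewrite -[RHS]card_Sn; apply: eq_card.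
Qed.

Definition del_tuple k (s : k.+1.-tuple T) (i : 'I_k.+1) : k.-tuple T :=
  [tuple tnth s (lift i l) | l < k].

Lemma del_tuple0 k (s : k.+1.-tuple T) : del_tuple s ord0 = behead s :> seq T.
Proof.
suff -> : del_tuple s ord0 = behead_tuple s by [].
case/tupleP: s => x s; apply: eq_from_tnth => l; rewrite tnth_mktuple tnthS.
by congr tnth; apply: val_inj.
Qed.

Lemma del_tupleS k x (s : k.+1.-tuple T) i :
  del_tuple [tuple of x :: s] (lift ord0 i) = x :: del_tuple s i :> seq T.
Proof.
suff -> : del_tuple [tuple of x :: s] (lift ord0 i) = [tuple of x :: del_tuple s i] by [].
apply: eq_from_tnth => l; rewrite [LHS]tnth_mktuple.
case: (unliftP ord0 l) => [m|] ->.
  rewrite tnthS tnth_mktuple.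
  have -> : lift (lift ord0 i) (lift ord0 m) = lift ord0 (lift i m); last by rewrite tnthS.
  by apply: val_inj; rewrite /= !/bump /= addnCA ltnS.
by rewrite tnth0; have -> : lift (lift ord0 i) ord0 = ord0; [apply: val_inj | rewrite tnth0].
Qed.

Lemma codiffE k c (s : k.+1.-tuple T) :
  codiff c s = \sum_(i < k.+1) (-1) ^+ i * c (del_tuple s i).
Proof.
elim: k c s => [|k IHk] c; case/tupleP=> x s.
  by rewrite big_ord1 expr0 mul1r del_tuple0 (tuple0 s) /= subr0.
rewrite [LHS]/= big_ord_recl expr0 mul1r del_tuple0; congr (_ + _).
rewrite IHk -sumrN; apply: eq_bigr => i _.
by rewrite del_tupleS [in RHS]exprS mulN1r mulNr.
Qed.

Lemma alts_cobound c (s : seq T) : alts (cobound c) s = codiff (alts c) s.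
Proof.
case: s => [|x s]; first by rewrite /= alts0 // => t /perm_nilP->.
have -> : x :: s = tval (in_tuple (x :: s)) by [].
move: (in_tuple (x :: s)); rewrite [size _]/=; move: (size s) => k {x}s.
rewrite codiffE altsE (partition_big (fun u : 'S_k.+1 => u ord0) xpredT) //.
apply: eq_bigr => i _.
rewrite (reindex (lift_perm ord0 i)); last first.
  pose ulsf i (v : 'S_k.+1) l := odflt l (unlift (v i) (v (lift i l))).
  have ulsfK i0 (v : 'S_k.+1) l : lift (v i0) (ulsf i0 v l) = v (lift i0 l).
    rewrite /ulsf; have := neq_lift i0 l; rewrite -(inj_eq (@perm_inj _ v)).
    by case/unlift_some=> ? ? ->.
  have inj_ulsf : injective (ulsf ord0 _).
    move=> v; apply: can_inj (ulsf (v ord0) v^-1%g) _ => l'.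
    by rewrite {1}/ulsf ulsfK !permK liftK.
  exists (fun v => perm (inj_ulsf v)) => [v _ | v].
    by apply/permP=> l'; rewrite permE /ulsf lift_perm_lift lift_perm_id liftK.
  rewrite inE => /eqP <-; apply/permP=> l'.
  case: (unliftP ord0 l') => [l|] ->; rewrite ?lift_perm_id //.
  by rewrite lift_perm_lift permE ulsfK.
under eq_bigl do rewrite lift_perm_id eqxx.
rewrite altsE mulr_sumr; apply: eq_bigr => u _.
rewrite odd_lift_perm [odd ord0]/= addFb signr_addb signr_odd mulrA; congr (_ * _).
have [y [t def_t]] : exists y, exists t : k.-tuple T,
    tuple_perm s (lift_perm ord0 i u) = [tuple of y :: t].
  by case/tupleP: (tuple_perm _ _) => y t; exists y, t.
suff -> : tuple_perm (del_tuple s i) u = t by rewrite def_t.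
apply: eq_from_tnth => l.
rewrite !tnth_mktuple -(lift_perm_lift ord0 i).
by have := congr1 (fun t0 => tnth t0 (lift ord0 l)) def_t; rewrite tnthS tnth_mktuple.
Qed.

Lemma alts_tens A c (s : seq T) : alts (tens A c) s = tens A (alts c) s.
Proof.
have -> : s = tval (in_tuple s) by [].
rewrite altsE tens_tuple.
under eq_bigr do rewrite tens_tuple mulr_sumr.
under [RHS]eq_bigr do rewrite altsE mulr_sumr.
rewrite [RHS]exchange_big; apply: eq_bigr => u _ /=.
have perm_inj_u : injective (fun t : (size s).-tuple T => tuple_perm t u).
  move=> t t' /(congr1 (fun t => tuple_perm t u^-1%g)).
  by rewrite !tuple_permM mulVg !tuple_perm1.
rewrite (reindex_inj perm_inj_u); apply: eq_bigr => t _ /=.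
rewrite mulrCA; congr (_ * _); rewrite [RHS](reindex_inj (@perm_inj _ u)) /=.
by apply: eq_bigr => i _; rewrite !tnth_mktuple.
Qed.

Section Sorting.

Variable key : T -> nat.

Definition key_sorted (s : seq T) := sorted gtn (map key s).

Definition on_sorted c (s : seq T) : F := if key_sorted s then c s else 0.

Lemma key_sorted_uniq s : key_sorted s -> uniq s.
Proof.
move=> /(sorted_uniq _ _) Us; apply: (@map_uniq _ _ key); apply: Us.
  by move=> a b d /= ba db; apply: ltn_trans ba.
by move=> a; apply: ltnn.
Qed.

Lemma key_sorted_perm_unique k (s : k.-tuple T) u :
  key_sorted s -> key_sorted (tuple_perm s u) -> u = 1%g.
Proof.
move=> Ss Su.
have : tuple_perm s u = s :> seq T.
  move: Ss Su; rewrite /key_sorted !(@sorted_map _ _ key) => Ss Su.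
  apply: (irr_sorted_eq _ _ Su Ss); last exact/perm_mem/perm_tuple_perm.
    by move=> a b d /= ba db; apply: ltn_trans ba.
  by move=> a; apply: ltnn.
move/val_inj/(congr1 (@tnth _ _))=> eq_s; apply/permP=> l; rewrite perm1.
have /tuple_uniqP inj_s := key_sorted_uniq Ss.
by apply: inj_s; rewrite -[in RHS]eq_s tnth_mktuple.
Qed.

Lemma alts_on_sorted c s : key_sorted s -> alts (on_sorted c) s = c s.
Proof.
move=> Ss; rewrite /alts (bigD1 1%g) // odd_perm1 mul1r tuple_perm1 {1}/on_sorted /= Ss.
rewrite big1 ?addr0 // => u nu1; rewrite /on_sorted; case: ifP => [Su|]; last by rewrite mulr0.
by rewrite (@key_sorted_perm_unique _ (in_tuple s) u) ?eqxx in nu1.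
Qed.

Lemma alts_on_sorted_alts c s : uniq (map key s) -> alts (on_sorted (alts c)) s = alts c s.
Proof.
move=> Us; pose leT x y := (key y <= key x)%N.
have leT_total : total leT by move=> a b; apply: leq_total.
have Sort : key_sorted (sort leT s).
  rewrite /key_sorted gtn_sorted_uniq_geq sorted_map sort_sorted // andbT.
  by rewrite (perm_uniq (perm_map _ (permEl (perm_sort _ _)))).
have /tuple_permP[u def_u] : perm_eq (sort leT s) (in_tuple s) by rewrite perm_sort.
have {}def_u : sort leT s = tuple_perm (in_tuple s) u by [].
have := alts_on_sorted (alts c) Sort.
by rewrite def_u !alts_perm; case: (odd_perm u); rewrite ?mulN1r ?mul1r // => /oppr_inj.
Qed.

Lemma codiff_alts_on_sorted c s : key_sorted s ->
  codiff (alts (on_sorted c)) s = codiff c s.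
Proof.
move=> Ss; apply: eq_codiff => t ts _; apply: alts_on_sorted.
apply: (subseq_sorted _ (map_subseq _ ts) Ss).
by move=> a b d /= ba db; apply: ltn_trans ba.
Qed.

End Sorting.

Section Flag.

Variable J : seq T -> T.
Hypothesis perm_J : forall s t, perm_eq s t -> J s = J t.

Fixpoint flag s : seq T := if s is x :: s' then J s :: flag s' else [::].

Lemma size_flag s : size (flag s) = size s.
Proof. by elim: s => //= x s ->. Qed.

Definition coflag c s := c (flag s).

Definition delete i s : seq T := take i s ++ drop i.+1 s.

Lemma codiff_delete c s : codiff c s = \sum_(i < size s) (-1) ^+ i * c (delete i s).
Proof.
elim: s c => [|x s IHs] c /=; first by rewrite big_ord0.
rewrite big_ord_recl expr0 mul1r /delete take0 drop1; congr (_ + _).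
rewrite IHs -sumrN; apply: eq_bigr => i _; rewrite [in RHS]exprS mulN1r mulNr.
by rewrite lift0.
Qed.

Lemma delete_flag_swap s1 x y s2 :
  delete (size s1).+1 (flag (s1 ++ x :: y :: s2)) =
  delete (size s1).+1 (flag (s1 ++ y :: x :: s2)).
Proof.
have swap s : perm_eq (s ++ x :: y :: s2) (s ++ y :: x :: s2).
  rewrite perm_cat2l (perm_cat2r s2 [:: x; y] [:: y; x]).
  exact: (permEl (perm_catC [:: x] [:: y])).
elim: s1 => [|z s1 IHs1]; rewrite /delete /=.
  by congr (_ :: _); apply: (perm_J (swap [::])).
by congr (_ :: _); [apply: (perm_J (swap (z :: s1))) | apply: IHs1].
Qed.

Lemma tuple_perm_swap k (t : k.-tuple T) (i j : 'I_k) : j = i.+1 :> nat ->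
  exists s1 x y s2, [/\ size s1 = i, t = s1 ++ x :: y :: s2 :> seq T
     & tuple_perm t (tperm i j) = s1 ++ y :: x :: s2 :> seq T].
Proof.
move=> def_j; pose x0 := tnth t i; have szt := size_tuple t.
have lt_jk : (i.+1 < k)%N by rewrite -def_j.
exists (take i t), (nth x0 t i), (nth x0 t i.+1), (drop i.+2 t).
have def_t : t = take i t ++ nth x0 t i :: nth x0 t i.+1 :: drop i.+2 t :> seq T.
  by rewrite -!drop_nth ?szt ?cat_take_drop // ltnW.
have sz1 : size (take i t) = i by rewrite size_takel // szt ltnW.
split=> //; have tpermE := @tnth_mktuple _ _ (fun l => tnth t (tperm i j l)).
apply: (@eq_from_nth _ x0) => [|l].
  by rewrite size_tuple -[LHS]szt [in LHS]def_t !size_cat.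
rewrite size_tuple => ltlk; pose l' := Ordinal ltlk.
rewrite -(tnth_nth x0 (tuple_perm t (tperm i j)) l') tpermE (tnth_nth x0) {1}def_t.
rewrite !nth_cat sz1.
case: tpermP => [/(congr1 val)/= -> | /(congr1 val)/= -> | /eqP neq_li /eqP neq_lj].
- by rewrite def_j ltnn ltnNge leqnSn /= subnn subSnn.
- by rewrite def_j ltnn ltnNge leqnSn /= subnn subSnn.
case: ifP => //= /negbT; rewrite -leqNgt => le_il.
have lt_il : (i < l)%N by rewrite ltn_neqAle le_il eq_sym andbT.
have lt_Sil : (i.+1 < l)%N by rewrite ltn_neqAle lt_il andbT -def_j eq_sym.
have -> : (l - i = (l - i.+2).+2)%N by rewrite -!subSn ?subSS // ltnW.
by [].
Qed.

Lemma alts_coflag_codiff c s : alts (coflag (codiff c)) s = alts (cobound (coflag c)) s.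
Proof.
case def_s: s => [|x0 s0].
  by rewrite !alts0 // => t /perm_nilP->.
rewrite -def_s; pose g i t := c (delete i (flag t)).
transitivity (alts (fun t => \sum_(i < size s) (-1) ^+ i * g i t) s).
  apply: eq_alts => t /perm_size szt.
  by rewrite /coflag codiff_delete size_flag szt.
rewrite alts_sum def_s big_ord_recl expr0 mul1r [X in _ + X]big1 => [|i _].
  rewrite addr0; apply: eq_alts => -[/perm_size // | x t _].
  by rewrite /g /delete /= ?take0 ?drop0.
apply/eqP; rewrite mulf_eq0; apply/orP; right; apply/eqP.
pose i' : 'I_(size s0).+1 := widen_ord (leqnSn _) i.
apply: (@alts_tperm_inv _ _ (in_tuple (x0 :: s0)) i' (lift ord0 i)).
  by rewrite -val_eqE /= neq_ltn ltnSn.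
move=> t _; have [] := @tuple_perm_swap _ t i' (lift ord0 i) (lift0 i).
move=> s1 [x [y [s2 [szs1 def_t ->]]]]; rewrite def_t /g lift0.
by rewrite (_ : nat_of_ord i = size s1) // delete_flag_swap.
Qed.

Lemma alts_cobound_coflag c s :
  alts (cobound (coflag (alts c))) s = alts (coflag (alts (cobound c))) s.
Proof.
rewrite -alts_coflag_codiff; apply: eq_alts => t _.
by rewrite /coflag alts_cobound.
Qed.

End Flag.

End Alternation.

(** * Chains as row vectors *)

Section Pairing.

Local Open Scope ring_scope.

Variables (F : numFieldType) (T : finType).

Implicit Types (c g : seq T -> F).

Local Notation ntuples k := #|{: k.-tuple T}|.

Definition cochain k c : 'cV[F]_(ntuples k) := \col_i c (enum_val i : k.-tuple T).

Lemma eq_cochain k c g :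
  (forall s : k.-tuple T, c s = g s) -> cochain k c = cochain k g.
Proof. by move=> eqcg; apply/colP=> i; rewrite !mxE eqcg. Qed.

Lemma cochain0 k c : (forall s : k.-tuple T, c s = 0) -> cochain k c = 0.
Proof. by move=> c0; apply/colP=> i; rewrite !mxE c0. Qed.

Lemma cochainB k c g : cochain k (fun s => c s - g s) = cochain k c - cochain k g.
Proof. by apply/colP=> i; rewrite !mxE. Qed.

Lemma cochainZ k a c : cochain k (fun s => a * c s) = a *: cochain k c.
Proof. by apply/colP=> i; rewrite !mxE. Qed.

Lemma cochain_surj k (v : 'cV[F]_(ntuples k)) : exists c, v = cochain k c.
Proof.
exists (fun s => if insub s is Some t then v (enum_rank (t : k.-tuple T)) 0 else 0).
by apply/colP=> i; rewrite mxE valK enum_valK.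
Qed.

Lemma mulmx_cochainE m k (M : 'M[F]_(m, ntuples k)) c i :
  (M *m cochain k c) i 0 = \sum_(t : k.-tuple T) M i (enum_rank t) * c t.
Proof.
rewrite mxE (reindex_onto enum_rank enum_val) => [|j _]; last exact: enum_valK.
by apply: eq_big => [t | t _]; rewrite ?mxE enum_rankK ?eqxx.
Qed.

Lemma sub_cochainP m1 m2 k (z : 'M[F]_(m1, ntuples k)) (M : 'M[F]_(m2, ntuples k)) :
  reflect (forall c, M *m cochain k c = 0 -> z *m cochain k c = 0) (z <= M)%MS.
Proof.
apply: (iffP idP) => [/submxP[v ->] c Mc0 | Hz]; first by rewrite -mulmxA Mc0 mulmx0.
rewrite submxE; apply/eqP/matrixP=> i j; rewrite [RHS]mxE.
have [c def_c] := cochain_surj (col j (cokermx M)).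
have /colP/(_ i) : z *m cochain k c = 0.
  by apply: Hz; rewrite -def_c colE mulmxA mulmx_coker mul0mx.
by rewrite -def_c colE mulmxA -colE !mxE.
Qed.

Lemma cochain_eq m k (z z' : 'M[F]_(m, ntuples k)) :
  (forall c, z *m cochain k c = z' *m cochain k c) -> z = z'.
Proof.
move=> eqz; apply/eqP; rewrite -subr_eq0 -submx0; apply/sub_cochainP=> c _.
by rewrite mulmxBl eqz subrr.
Qed.

Lemma boundary_cochain k c :
  boundary F T k *m cochain k.-1 c = cochain k (cobound c).
Proof.
apply/colP=> i; rewrite mulmx_cochainE mxE; set s := enum_val i.
case: k i @s => [|k] i; first by rewrite big1 => [|t _]; rewrite ?mxE ?mul0r // tuple0.
set s := enum_val i; rewrite (bigD1 (behead_tuple s)) //= big1 => [|t ne_t].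
  by rewrite addr0 mxE enum_rankK -/s eqxx mul1r; case/tupleP: (s).
by rewrite mxE enum_rankK -/s eq_sym (negPf ne_t) mul0r.
Qed.

Section Tens.
Variable A : T -> T -> F.

Definition tens_mx k : 'M[F]_(ntuples k) :=
  \matrix_(i, j) \prod_(l < k) A (tnth (enum_val i) l) (tnth (enum_val j) l).

Lemma tens_mx_cochain k c : tens_mx k *m cochain k c = cochain k (tens A c).
Proof.
apply/colP=> i; rewrite mulmx_cochainE mxE tens_tuple.
by apply: eq_bigr => t _; rewrite mxE enum_rankK.
Qed.
End Tens.

Section Flag.
Variable J : seq T -> T.

Definition flag_mx k : 'M[F]_(ntuples k) :=
  \matrix_(i, j) alts (fun t => (t == (enum_val j : k.-tuple T))%:R)
                      (flag J (enum_val i : k.-tuple T)).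

Lemma flag_mx_cochain k c :
  flag_mx k *m cochain k c = cochain k (coflag J (alts c)).
Proof.
apply/colP=> i; rewrite mulmx_cochainE mxE /coflag.
under eq_bigr do rewrite mxE enum_rankK mulrC.
rewrite -alts_sum; apply: eq_alts => t /perm_size; rewrite size_flag size_tuple => szt.
have [t' ->] : exists t' : k.-tuple T, t = t' by have /eqP szt' := szt; exists (Tuple szt').
rewrite (bigD1 t') //= eqxx mulr1 big1 ?addr0 // => t1 /negPf net1.
by rewrite val_eqE eq_sym net1 mulr0.
Qed.
End Flag.

Variables (aT : finGroupType) (to : {action aT &-> T}) (K : simplicial_complex to).

Lemma chains_cochain k c :
  chains F K k *m cochain k c =
    cochain k (fun s => if uniq s && ([set x in s] \in faces K) then alts c s else 0).
Proof.
apply/row_matrixP=> i; rewrite -(enum_valK i) row_mul row_chains /ordered_simplex.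
set s := enum_val i; apply/rowP=> j; rewrite [RHS]mxE [in RHS]mxE enum_rankK.
case: ifP => _; last by rewrite mul0mx mxE.
rewrite altsE mulmx_suml summxE; apply: eq_bigr => u _.
by rewrite -scalemxAl -rowE !mxE enum_rankK.
Qed.

Lemma chains_pairP m k (z : 'M[F]_(m, ntuples k)) :
  reflect (forall c, (forall s : k.-tuple T, ordered_simplex K s -> alts c s = 0) ->
             z *m cochain k c = 0)
    (z <= chains F K k)%MS.
Proof.
apply: (iffP (sub_cochainP _ _)) => Hz c Hc; apply: Hz.
  by rewrite chains_cochain; apply: cochain0 => s; case: ifP => // /Hc.
move=> s Ks; move: Hc; rewrite chains_cochain => /colP/(_ (enum_rank s)).
by rewrite !mxE enum_rankK; move: Ks; rewrite /ordered_simplex => ->.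
Qed.

Lemma boundaries_pairP m k (z : 'M[F]_(m, ntuples k)) :
  reflect (forall c,
     (forall s : k.+1.-tuple T, ordered_simplex K s -> alts (cobound c) s = 0) ->
             z *m cochain k c = 0)
    (z <= boundaries F K k)%MS.
Proof.
rewrite /boundaries genmxE.
apply: (iffP (sub_cochainP _ _)) => Hz c Hc; apply: Hz.
  rewrite -mulmxA -[cochain k c]/(cochain k.+1.-1 c) boundary_cochain chains_cochain.
  by apply: cochain0 => s; case: ifP => // /Hc.
move=> s Ks; move: Hc.
rewrite -mulmxA -[cochain k c]/(cochain k.+1.-1 c) boundary_cochain chains_cochain.
move=> /colP/(_ (enum_rank s)).
by rewrite !mxE enum_rankK; move: Ks; rewrite /ordered_simplex => ->.
Qed.

Lemma eq_chains_cochain m k (z : 'M[F]_(m, ntuples k)) c g :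
    (z <= chains F K k)%MS ->
    (forall s : k.-tuple T, ordered_simplex K s -> alts c s = alts g s) ->
  z *m cochain k c = z *m cochain k g.
Proof.
move=> /chains_pairP Kz eqcg; apply/eqP; rewrite -subr_eq0 -mulmxBr -cochainB.
by apply/eqP/Kz => s Ks; rewrite altsB eqcg // subrr.
Qed.

Lemma cycles_cobound m k (z : 'M[F]_(m, ntuples k)) c :
  (z <= cycles F K k)%MS -> z *m cochain k (cobound c) = 0.
Proof.
rewrite sub_capmx => /andP[_ /sub_kermxP z0].
by rewrite -boundary_cochain mulmxA z0 mul0mx.
Qed.

Lemma cyclesP m k (z : 'M[F]_(m, ntuples k)) :
    (z <= chains F K k)%MS -> (forall c, z *m cochain k (cobound c) = 0) ->
  (z <= cycles F K k)%MS.
Proof.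
move=> Kz z0; rewrite sub_capmx Kz; apply/sub_kermxP; apply: cochain_eq => c.
by rewrite -mulmxA boundary_cochain z0 mul0mx.
Qed.

Lemma cycles_chains m k (z : 'M[F]_(m, ntuples k)) :
  (z <= cycles F K k)%MS -> (z <= chains F K k)%MS.
Proof. by rewrite sub_capmx => /andP[]. Qed.

End Pairing.

Section SectionSimilarity.

Local Open Scope ring_scope.

Lemma section_rsim (F : fieldType) (gT : finGroupType) (G : {group gT}) n1 n2
    (rG1 : mx_representation F G n1) (rG2 : mx_representation F G n2)
    (U1 V1 : 'M_n1) (U2 V2 : 'M_n2)
    (modU1 : mxmodule rG1 U1) (modV1 : mxmodule rG1 V1)
    (modU2 : mxmodule rG2 U2) (modV2 : mxmodule rG2 V2) (f : 'M_(n1, n2)) :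
    (forall x, x \in G -> rG1 x *m f = f *m rG2 x) ->
    (U1 *m f <= U2)%MS -> (V1 *m f :=: V2)%MS ->
    (forall z : 'rV_n1, (z <= V1)%MS -> (z *m f <= U2)%MS -> (z <= U1)%MS) ->
  mx_rsim (section_repr modU1 modV1) (section_repr modU2 modV2).
Proof.
move=> homf sUf eqVf injf; set m1 := {1}(\rank _).
pose v1 := val_factmod (val_submod (1%:M : 'M_m1)).
have sv1: (v1 <= U1 + V1)%MS.
  by rewrite (submx_trans _ (proj_factmodS _ _)) // submxMr // val_submod1 genmxE.
have sV1 : (V1 <= U1 + v1)%MS.
  rewrite -[V1 in X in (X <= _)%MS](add_sub_fact_mod U1).
  rewrite addmx_sub_adds ?val_submodP //.
  have WV1 : (in_factmod U1 V1 <= <<in_factmod U1 V1>>)%MS by rewrite genmxE.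
  rewrite -{1}(in_submodK WV1) val_submodE val_factmodE -mulmxA -val_factmodE.
  exact: submxMl.
have sv1f : (v1 *m f <= U2 + V2)%MS.
  by rewrite (submx_trans (submxMr f sv1)) // addsmxMr addsmxS // eqVf.
have {}injf (z : 'rV_n1) : (z <= U1 + V1)%MS -> (z *m f <= U2)%MS -> (z <= U1)%MS.
  case/sub_addsmxP=> -[a b] -> /=; rewrite mulmxDl => Uab.
  have Ua := submxMl a U1; rewrite addmx_sub // injf ?submxMl //.
  rewrite -[_ *m f](addKr (a *m U1 *m f)) addmx_sub // -mulNmx.
  by rewrite (submx_trans _ sUf) // submxMr // eqmx_opp.
have B_free: row_free (v1 *m f *m in_factmod U2 1%:M *m in_submod <<in_factmod U2 V2>>%MS 1%:M).
  rewrite -kermx_eq0; apply/rowV0P=> u; rewrite (sameP sub_kermxP eqP) mulmxA.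
  rewrite -in_submodE mulmxA -in_factmodE -(inj_eq val_submod_inj) linear0.
  rewrite in_submodK ?in_factmod_eq0 => [U2uv1|]; last first.
    by rewrite genmxE -(in_factmod_addsK U2 V2) submxMr // mulmx_sub.
  apply: val_submod_inj; apply/eqP; rewrite linear0 -[val_submod u]val_factmodK.
  rewrite in_factmod_eq0 val_factmodE val_submodE -mulmxA -val_factmodE.
  by apply: injf; [apply: mulmx_sub | rewrite -mulmxA].
exists (v1 *m f *m in_factmod _ 1%:M *m in_submod _ 1%:M) => [||x Gx] //.
  apply/eqP; rewrite eqn_leq; apply/andP; split.
    by move: B_free; rewrite /row_free => /eqP {1}<-; apply: rank_leq_col.
  have <- : \rank (in_factmod U2 (v1 *m f)) = \rank <<in_factmod U2 V2>>%MS.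
    rewrite genmxE; apply: eqmx_rank; apply/andP; split.
      by rewrite -(in_factmod_addsK U2 V2) submxMr.
    apply: (@submx_trans _ _ _ _ _ _ (in_factmod U2 ((U1 + v1)%MS *m f))).
      by rewrite submxMr // -eqVf submxMr.
    by rewrite -(in_factmod_addsK U2 (v1 *m f)) submxMr // addsmxMr addsmxS.
  exact: rank_leq_row.
symmetry; rewrite -{1}in_submodE -{1}in_factmodE -{1}in_submodJ; last first.
  by rewrite genmxE -(in_factmod_addsK U2 V2) submxMr.
rewrite -{1}in_factmodJ // mulmxA in_submodE; congr (_ *m _); apply/eqP.
rewrite mulmxA -in_factmodE -subr_eq0 -linearB in_factmod_eq0.
rewrite -mulmxA -homf // mulmxA [X in _ - X]mulmxA -mulmxBl (submx_trans _ sUf) // submxMr //.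
rewrite -in_factmod_eq0 linearB /= subr_eq0 {1}(in_factmodJ modU1) //.
rewrite val_factmodK /v1 val_factmodE eq_sym mulmxA -val_factmodE val_factmodK.
by rewrite -[_ *m _]mul1mx mulmxA -val_submodE val_submodJ.
Qed.

End SectionSimilarity.

(** * The comparison theorem *)

Section Comparison.

Local Open Scope ring_scope.

Variables (F : numFieldType) (aT : finGroupType) (T : finType).
Variables (to : {action aT &-> T}) (K L : simplicial_complex to).
Variables (A : T -> T -> F) (J : seq T -> T) (key : T -> nat).
Variables (N : pred (seq T)) (k : nat) (w : F).

Implicit Types c : seq T -> F.

Definition simplex (X : simplicial_complex to) (s : seq T) :=
  uniq s && ([set x in s] \in faces X).

Definition carried (s t : seq T) :=
  forall y, y \in t -> exists2 x, x \in s & A x y != 0.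

Hypothesis A1 : forall x, \sum_y A x y = 1.
Hypothesis A_act : forall x y a, A (to x a) (to y a) = A x y.
Hypothesis perm_J : forall s t, perm_eq s t -> J s = J t.
Hypothesis perm_N : forall s t, perm_eq s t -> N s -> N t.
Hypothesis simplexK_key : forall s, simplex K s -> uniq (map key s).
Hypothesis simplexK_flag : forall s, simplex K s -> key_sorted key s -> flag J s = s.
Hypothesis simplexK_flag_nonuniq :
  forall s, simplex K s -> ~~ key_sorted key s -> ~~ uniq (flag J s).
Hypothesis N_flag : forall s, N s -> uniq (flag J s) -> simplex K (flag J s).
Hypothesis simplexL_N : forall s, simplex L s -> N s.
Hypothesis carriedL : forall s (t : seq T), (k <= size s)%N -> simplex K s ->
  carried s t -> uniq t -> simplex L t.
Hypothesis carriedN : forall s (t : seq T), (k <= size s)%N -> simplex K s ->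
  (forall y, y \in t -> y \in s \/ exists2 x, x \in s & A x y != 0) -> N t.
Hypothesis w_neq0 : w != 0.
Hypothesis tens_flag : forall (c : seq T -> F) s, size s = k -> simplex L s ->
  tens A (alts c) (flag J s) = w * alts c s.

Lemma simplex_perm X s t : perm_eq s t -> simplex X s = simplex X t.
Proof.
move=> st; rewrite /simplex (perm_uniq st); suff -> : [set x in s] = [set x in t] by [].
by apply/setP=> x; rewrite !inE (perm_mem st).
Qed.

Lemma tens_map_act c s a :
  tens A (fun t => c (map (to^~ a) t)) s = tens A c (map (to^~ a) s).
Proof.
have inj_a : injective (to^~ a) := act_inj to a.
elim: s c => //= x s IHs c; rewrite [RHS](reindex_inj inj_a) /=.
by apply: eq_bigr => y _; rewrite A_act -IHs.
Qed.

Lemma tuple_repr_tens a :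
  tuple_repr F to k a *m tens_mx A k = tens_mx A k *m tuple_repr F to k a.
Proof.
have reprE c : tuple_repr F to k a *m cochain k c =
    cochain k (fun s => c (map (to^~ a) s)).
  apply/row_matrixP=> i; rewrite -(enum_valK i) row_mul row_tuple_mx -rowE.
  by apply/rowP=> j; rewrite !mxE !enum_rankK.
apply: cochain_eq => c; rewrite -!mulmxA tens_mx_cochain !reprE tens_mx_cochain.
by apply: eq_cochain => s; rewrite tens_map_act.
Qed.

Lemma tens_vanish c s : (k <= size s)%N -> simplex K s ->
    (forall t, size t = size s -> simplex L t -> alts c t = 0) ->
  alts (tens A c) s = 0.
Proof.
move=> le_ks Ks c0; rewrite alts_tens -[RHS](tens0 A s); apply: eq_tens => t szt At.
have [Ut | /alts_nonuniq-> //] := boolP (uniq t).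
by apply: c0 => //; apply: carriedL Ks At Ut.
Qed.

Lemma coflag_vanish c s : N s ->
    (forall t, size t = size s -> simplex K t -> alts c t = 0) ->
  alts (coflag J (alts c)) s = 0.
Proof.
move=> Ns c0; apply: alts0 => t st; rewrite /coflag.
have Nt : N t by apply: perm_N Ns; rewrite perm_sym.
have [Ut | /alts_nonuniq-> //] := boolP (uniq (flag J t)).
by apply: c0; [rewrite size_flag (perm_size st) | apply: N_flag].
Qed.

Lemma chains_tens m (z : 'M_(m, _)) :
  (z <= chains F K k)%MS -> (z *m tens_mx A k <= chains F L k)%MS.
Proof.
move=> /chains_pairP Kz; apply/chains_pairP=> c c0; rewrite -mulmxA tens_mx_cochain.
apply: Kz => s Ks; apply: tens_vanish => // [|t]; first by rewrite size_tuple.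
by rewrite size_tuple => /eqP szt Lt; apply: (c0 (Tuple szt)).
Qed.

Lemma cycles_tens m (z : 'M_(m, _)) :
  (z <= cycles F K k)%MS -> (z *m tens_mx A k <= cycles F L k)%MS.
Proof.
move=> Kz; apply: cyclesP => [|c]; first exact/chains_tens/(cycles_chains Kz).
rewrite -mulmxA tens_mx_cochain (eq_cochain (g := cobound (tens A c))).
  exact: cycles_cobound Kz.
by move=> s; rewrite tens_cobound.
Qed.

Lemma boundaries_tens m (z : 'M_(m, _)) :
  (z <= boundaries F K k)%MS -> (z *m tens_mx A k <= boundaries F L k)%MS.
Proof.
move=> /boundaries_pairP Kz; apply/boundaries_pairP=> c c0.
rewrite -mulmxA tens_mx_cochain; apply: Kz => s Ks.
rewrite (eq_alts (g := tens A (cobound c))) => [|t _]; last by rewrite tens_cobound.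
apply: tens_vanish => // [|t]; first by rewrite size_tuple leqnSn.
by rewrite size_tuple => /eqP szt Lt; apply: (c0 (Tuple szt)).
Qed.

Lemma cycles_flag m (z : 'M_(m, _)) :
  (z <= cycles F L k)%MS -> (z *m flag_mx F J k <= cycles F K k)%MS.
Proof.
move=> Lz; have zL := cycles_chains Lz; apply: cyclesP => [|c]; last first.
  rewrite -mulmxA flag_mx_cochain.
  rewrite (eq_chains_cochain (g := cobound (coflag J (alts c))) zL).
    exact: cycles_cobound Lz.
  by move=> s Ls; rewrite alts_cobound_coflag.
apply/chains_pairP=> c c0; rewrite -mulmxA flag_mx_cochain.
move/chains_pairP: zL; apply=> s Ls; apply: coflag_vanish => [|t].
  exact: simplexL_N.
by rewrite size_tuple => /eqP szt Kt; apply: (c0 (Tuple szt)).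
Qed.

Lemma chains_flag_tens m (z : 'M_(m, _)) : (z <= chains F L k)%MS ->
  z *m flag_mx F J k *m tens_mx A k = (w * k`!%:R) *: z.
Proof.
move=> Lz; apply: cochain_eq => c.
rewrite -!mulmxA tens_mx_cochain flag_mx_cochain -scalemxAl scalemxAr -cochainZ.
apply: eq_chains_cochain Lz _ => s Ls.
transitivity (alts (fun t => w * alts c t) s).
  apply: eq_alts => t st; rewrite /coflag alts_tens tens_flag //.
    by rewrite (perm_size st) size_tuple.
  by rewrite (simplex_perm _ st).
have altsZ (a : F) g : alts (fun t => a * g t) s = a * alts g s.
  by rewrite /alts mulr_sumr; apply: eq_bigr => u _; rewrite mulrCA.
by rewrite !altsZ alts_alts size_tuple mulrA.
Qed.

Lemma boundaries_tens_inj m (z : 'M_(m, _)) : (z <= cycles F K k)%MS ->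
  (z *m tens_mx A k <= boundaries F L k)%MS -> (z <= boundaries F K k)%MS.
Proof.
move=> Kz /boundaries_pairP Lz; apply/boundaries_pairP=> c c0.
have zK := cycles_chains Kz; pose c' := coflag J (alts c).
have c'0 s : N s -> size s = k.+1 -> alts (cobound c') s = 0.
  move=> Ns szs; rewrite alts_cobound_coflag //; apply: coflag_vanish => // t.
  by rewrite szs => /eqP szt Kt; apply: (c0 (Tuple szt)).
have -> : z *m cochain k c = z *m cochain k c'.
  apply: eq_chains_cochain zK _ => s Ks.
  rewrite -(alts_on_sorted_alts c (simplexK_key Ks)); apply: eq_alts => t st.
  have Kt : simplex K t by rewrite (simplex_perm _ st).
  rewrite /on_sorted /c' /coflag; case: ifP => [/simplexK_flag-> // | /negbT St].
  by rewrite alts_nonuniq // simplexK_flag_nonuniq.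
have : z *m tens_mx A k *m cochain k c' = 0.
  by apply: Lz => s Ls; apply: c'0; rewrite ?size_tuple //; apply: simplexL_N.
rewrite -mulmxA tens_mx_cochain => <-; apply/eqP; rewrite eq_sym -subr_eq0.
rewrite -mulmxBr -cochainB; apply/eqP; pose b := prism A (alts c').
rewrite -[RHS](cycles_cobound (on_sorted key b) Kz).
apply: eq_chains_cochain zK _ => s Ks; have Us := simplexK_key Ks.
rewrite -(alts_on_sorted_alts _ Us) -[RHS](alts_on_sorted_alts _ Us).
apply: eq_alts => t st; have Kt : simplex K t by rewrite (simplex_perm _ st).
rewrite /on_sorted; case: ifP => // St; rewrite -/(on_sorted _ _).
rewrite alts_cobound codiff_alts_on_sorted // altsB alts_tens -prism_homotopy //.
rewrite -[RHS]add0r -/b; congr (_ + _); rewrite -[RHS](prism0 A t).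
have szt : size t = k by rewrite (perm_size st) size_tuple.
apply: eq_prism => t' szt' At'; rewrite -alts_cobound c'0 ?szt' ?szt //.
by apply: carriedN At'; rewrite ?szt.
Qed.

Lemma homology_rsim :
  mx_rsim (section_repr (boundaries_module F K k) (cycles_module F K k))
          (section_repr (boundaries_module F L k) (cycles_module F L k)).
Proof.
apply: (@section_rsim _ _ _ _ _ _ _ _ _ _ _ _ _ _ _ (tens_mx A k)).
- by move=> a _; apply: tuple_repr_tens.
- exact: boundaries_tens.
- apply/eqmxP; rewrite cycles_tens //=.
  have nz : w * k`!%:R != 0 by rewrite mulf_neq0 // pnatr_eq0 -lt0n fact_gt0.
  rewrite -(eqmx_scale _ nz) -chains_flag_tens; last exact: cycles_chains.
  by rewrite submxMr // cycles_flag.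
by move=> z; apply: boundaries_tens_inj.
Qed.

End Comparison.

(** * Groups generated by p-cycles *)

Section Support.

Variable n : nat.
Implicit Types (G H E P : {group 'S_n}) (A : {set 'S_n}) (x y z : 'I_n).

Definition supp A : {set 'I_n} := [set x | [exists g in A, g x != x]].

Lemma suppP A x : reflect (exists2 g, g \in A & g x != x) (x \in supp A).
Proof. by rewrite inE; apply: (iffP exists_inP). Qed.

Lemma suppPn A x : reflect (forall g, g \in A -> g x = x) (x \notin supp A).
Proof.
apply: (iffP idP) => [/suppP Ax g Ag | Ax].
  by apply/eqP; apply/negPn/negP=> ngx; apply: Ax; exists g.
by apply/suppP=> -[g /Ax->]; rewrite eqxx.
Qed.

Lemma suppS A (B : {set 'S_n}) : A \subset B -> supp A \subset supp B.
Proof.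
by move=> sAB; apply/subsetP=> x /suppP[g Ag ngx]; apply/suppP; exists g; rewrite ?(subsetP sAB).
Qed.

Lemma cent_perm A G g h x : A \subset 'C(G) -> g \in A -> h \in G -> g (h x) = h (g x).
Proof.
by move=> cAG Ag Gh; have /centP/(_ h Gh) := subsetP cAG g Ag => cgh; rewrite -!permM cgh.
Qed.

Lemma cent_supp A G g x : A \subset 'C(G) -> g \in A -> x \in supp G -> g x \in supp G.
Proof.
move=> cAG Ag /suppP[h Gh nhx]; apply/suppP; exists h => //.
by rewrite -(cent_perm _ cAG) // (inj_eq perm_inj).
Qed.

Lemma orbit_perm G g x : g \in G -> g x \in orbit 'P G x.
Proof. by move=> Gg; apply/orbitP; exists g. Qed.

Lemma orbit_sub_perm G (S : {set 'I_n}) x :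
  (forall g y, g \in G -> y \in S -> g y \in S) -> x \in S -> orbit 'P G x \subset S.
Proof. by move=> GS Sx; apply/subsetP=> _ /orbitP[g Gg <-]; apply: GS. Qed.

Lemma orbit_gen_sub A (S : {set 'I_n}) x :
  (forall g y, g \in A -> y \in S -> g y \in S) -> x \in S -> orbit 'P <<A>> x \subset S.
Proof.
move=> AS; apply: (@orbit_sub_perm <<A>>) => g y Ag Sy.
have sAN : <<A>> \subset 'N(S | 'P).
  rewrite gen_subG; apply/subsetP=> h Ah; rewrite !inE /=; apply/subsetP=> z Sz.
  by rewrite inE /= AS.
by have := astabs_act y (subsetP sAN g Ag); rewrite /= Sy.
Qed.

Lemma supp_gen_sub A : supp <<A>> \subset supp A.
Proof.
apply/subsetP=> x; apply: contraLR => /suppPn Ax; apply/suppPn=> g Ag.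
have sub : <<A>> \subset 'C[x | 'P].
  by rewrite gen_subG; apply/subsetP=> h Ah; apply/astab1P; apply: Ax.
by have /astab1P := subsetP sub g Ag.
Qed.

End Support.

Section PCycles.

Variables p n : nat.
Hypothesis p_pr : prime p.
Implicit Types (G H E P : {group 'S_n}) (A : {set 'S_n}) (x y z : 'I_n).

Local Notation PC := (p_cycle_subgroups p n).
Local Notation Q := (elementary_abelian_subgroups p n).

Lemma p_cycle_order (c : 'S_n) : is_p_cycle p c -> #[c] = p.
Proof.
case/existsP=> x /andP[/eqP card_cx on_c].
apply: nt_prime_order => //.
  apply/permP=> y; rewrite perm1 permX.
  have [cy | ncy] := boolP (y \in porbit c x); last first.
    have fix_y : c y = y by apply: out_perm on_c ncy.
    by elim: (p) => //= m ->.
  by rewrite -card_cx; move: cy; rewrite porbit_sym -eq_porbit_mem => /eqP->; apply: iter_porbit.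
apply: contraTneq (prime_gt1 p_pr) => c1; rewrite -card_cx c1 -leqNgt.
have -> : porbit 1 x = [set x]; last by rewrite cards1.
apply/setP=> y; rewrite inE; apply/porbitP/eqP => [[i ->] | ->]; last by exists 0; rewrite perm1.
by rewrite expg1n perm1.
Qed.

Lemma p_cycle_subgroupP P :
  reflect (exists2 c, is_p_cycle p c & P = <[c]>%G) (P \in PC).
Proof.
by apply: (iffP imsetP) => -[c]; rewrite ?inE => cc ->; exists c; rewrite ?inE.
Qed.

Lemma p_cycle_card P : P \in PC -> #|P| = p.
Proof. by case/p_cycle_subgroupP=> c cc ->; apply: p_cycle_order. Qed.

Lemma p_cycle_suppE (c : 'S_n) x :
  #|porbit c x| = p -> perm_on (porbit c x) c -> supp <[c]> = porbit c x.
Proof.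
move=> card_cx on_c; apply/setP=> y; apply/idP/idP.
  apply: contraLR => ncy; apply/suppPn=> _ /cycleP[i ->].
  have fix_y : c y = y by apply: out_perm on_c ncy.
  by rewrite permX; elim: i => //= i ->.
rewrite porbit_sym -eq_porbit_mem => /eqP eq_cxy; apply: contraLR (prime_gt1 p_pr).
move=> /suppPn fix_y; rewrite -leqNgt -card_cx eq_cxy -(cards1 y) subset_leq_card //.
apply/subsetP=> z /porbitP[i ->]; rewrite inE; apply/eqP/fix_y; exact: mem_cycle.
Qed.

Lemma p_cycle_supp P : P \in PC -> #|supp P| = p.
Proof.
by case/p_cycle_subgroupP=> c /existsP[x /andP[/eqP cx on_c]] ->; rewrite (p_cycle_suppE cx).
Qed.

Lemma p_cycle_trans P x : P \in PC -> x \in supp P -> orbit 'P P x = supp P.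
Proof.
case/p_cycle_subgroupP=> c /existsP[y /andP[/eqP cy on_c]] ->.
by rewrite (p_cycle_suppE cy) // -eq_porbit_mem => /eqP <-; rewrite porbitE.
Qed.

Lemma p_cycle_transP P x y :
  P \in PC -> x \in supp P -> y \in supp P -> exists2 c, c \in P & y = c x.
Proof.
move=> PP Px; rewrite -(p_cycle_trans PP Px) => /orbitP[c Pc <-].
by exists c.
Qed.

Lemma p_cycle_abelian P : P \in PC -> abelian P.
Proof. by case/p_cycle_subgroupP=> c _ ->; apply: cycle_abelian. Qed.

Lemma p_cycle_elementary P : P \in PC -> P \in Q.
Proof.
move=> PP; have oP := p_cycle_card PP; rewrite inE prime_abelem //=.
by rewrite trivg_card1 oP; case: p p_pr => [|[|]].
Qed.

Lemma p_cycle_supp_neq0 P : P \in PC -> exists x, x \in supp P.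
Proof.
move=> PP; apply/set0Pn; rewrite -card_gt0 p_cycle_supp //; exact: prime_gt0.
Qed.

Lemma cent_p_cycle_eq P g h x z : P \in PC -> g \in 'C(P) -> h \in 'C(P) ->
  x \in supp P -> z \in supp P -> g x = h x -> g z = h z.
Proof.
move=> PP Cg Ch Px Pz eq_gh; have [d Pd ->] := p_cycle_transP PP Px Pz.
by rewrite (cent_perm _ (subxx 'C(P))) // (cent_perm _ (subxx 'C(P)) Ch) // eq_gh.
Qed.

Lemma commuting_p_cycles_eq P P' x : P \in PC -> P' \in PC -> P' \subset 'C(P) ->
  x \in supp P -> x \in supp P' -> P = P'.
Proof.
move=> PP PP' cPP' Px P'x; apply/val_inj/eqP.
rewrite eq_sym eqEcard /= !p_cycle_card // leqnn andbT.
have eqS : supp P' = supp P.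
  apply/eqP; rewrite eqEcard !p_cycle_supp // leqnn andbT; apply/subsetP=> y P'y.
  by have [c P'c ->] := p_cycle_transP PP' P'x P'y; apply: cent_supp cPP' P'c Px.
apply/subsetP=> c' P'c'.
have [c Pc eqc] := p_cycle_transP PP Px (cent_supp cPP' P'c' Px).
suff -> : c' = c by [].
have Cc : c \in 'C(P) by apply: (subsetP (p_cycle_abelian PP)).
apply/permP=> z; have [Pz | nPz] := boolP (z \in supp P).
  exact: (cent_p_cycle_eq PP (subsetP cPP' c' P'c') Cc Px Pz eqc).
have nP'z : z \notin supp P' by rewrite eqS.
by rewrite (suppPn _ _ nP'z c') // (suppPn _ _ nPz c).
Qed.

Lemma orbit_p_group E x : p.-group E -> exists a, #|orbit 'P E x| = (p ^ a)%N.
Proof.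
move=> pE; have /p_natP[a ->] : p.-nat #|orbit 'P E x|; last by exists a.
by rewrite card_orbit; apply: pnat_dvd (dvdn_indexg _ _) pE.
Qed.

Lemma leq_orbit_supp E x : p.-group E -> x \in supp E -> (p <= #|orbit 'P E x|)%N.
Proof.
move=> pE /suppP[g Eg ngx]; have [a card_a] := orbit_p_group x pE; rewrite card_a.
have : (1 < p ^ a)%N.
  by rewrite -card_a (cardD1 x) orbit_refl (cardD1 (g x)) !inE ngx /= orbit_perm.
case: a {card_a} => [|a] // _.
by rewrite -{1}[p]expn1 leq_exp2l // prime_gt1.
Qed.

Definition small E := [forall x, #|orbit 'P E x| <= p].

Lemma smallS E E' : E \subset E' -> small E' -> small E.
Proof.
move=> sEE' /forallP sE'; apply/forallP=> x; apply: leq_trans (sE' x).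
by apply/subset_leq_card/imsetS.
Qed.

Lemma small_orbit E x : p.-group E -> small E -> x \in supp E -> #|orbit 'P E x| = p.
Proof.
move=> pE /forallP/(_ x) sE Ex; apply/eqP.
by rewrite eqn_leq sE leq_orbit_supp.
Qed.

(* For E elementary abelian with all orbits of size at most p, these are the
   subgroups generated by the p-cycles c_O obtained by restricting elements of
   E to its nontrivial orbits O. *)
Definition cycle_factors E : {set {group 'S_n}} :=
  [set P in PC | (E \subset 'C(P)) && (supp P \subset supp E)].

Lemma cycle_factorsP E P :
  reflect [/\ P \in PC, E \subset 'C(P) & supp P \subset supp E] (P \in cycle_factors E).
Proof. by rewrite inE; apply: and3P. Qed.

Lemma cycle_factor_orbit E P x : p.-group E -> P \in cycle_factors E ->
  x \in supp P -> orbit 'P E x = supp P.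
Proof.
move=> pE /cycle_factorsP[PP cEP sPE] Px.
have sOP : orbit 'P E x \subset supp P.
  by apply: orbit_sub_perm Px => g y; apply: cent_supp cEP.
apply/eqP; rewrite eqEcard sOP p_cycle_supp //=.
exact: leq_orbit_supp (subsetP sPE x Px).
Qed.

Lemma cycle_factor_agree E P c x : p.-group E -> P \in cycle_factors E ->
  c \in P -> x \in supp P -> exists2 g, g \in E & {in supp P, g =1 c}.
Proof.
move=> pE EP Pc Px; have [PP cEP _] := cycle_factorsP _ _ EP.
have Pcx : c x \in supp P.
  by apply: cent_supp (p_cycle_abelian PP) Pc Px.
have /orbitP[g Eg eq_gc] : c x \in orbit 'P E x by rewrite (cycle_factor_orbit pE EP).
have {}eq_gc : g x = c x := eq_gc; exists g => // z Pz.
exact: (cent_p_cycle_eq PP (subsetP cEP g Eg) (subsetP (p_cycle_abelian PP) c Pc) Px Pz eq_gc).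
Qed.

Lemma cycle_factors_cent E P P' : p.-group E ->
  P \in cycle_factors E -> P' \in cycle_factors E -> P' \subset 'C(P).
Proof.
move=> pE EP EP'.
have comm_at P1 P2 c1 c2 x : P1 \in cycle_factors E -> P2 \in cycle_factors E ->
    c1 \in P1 -> c2 \in P2 -> x \in supp P1 -> c2 (c1 x) = c1 (c2 x).
  move=> EP1 EP2 P1c P2c P1x; have [g Eg eq_gc] := cycle_factor_agree pE EP1 P1c P1x.
  have [PP2 cEP2 _] := cycle_factorsP _ _ EP2.
  rewrite -eq_gc // -(cent_perm _ cEP2 Eg P2c) eq_gc //.
  have [P2x | nP2x] := boolP (x \in supp P2); last by rewrite (suppPn _ _ nP2x c2).
  rewrite -(cycle_factor_orbit pE EP1 P1x) (cycle_factor_orbit pE EP2 P2x).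
  exact: cent_supp (p_cycle_abelian PP2) P2c P2x.
apply/centsP=> c' P'c' c Pc; apply/permP=> x; rewrite !permM.
have [Px | nPx] := boolP (x \in supp P); first by apply/esym/(comm_at P P').
have [P'x | nP'x] := boolP (x \in supp P'); first by apply: (comm_at P' P).
by rewrite (suppPn _ _ nP'x c') // (suppPn _ _ nPx c) // (suppPn _ _ nP'x c').
Qed.

Lemma cycle_factorsS E E' : E \subset E' -> p.-group E' -> abelian E' -> small E' ->
  cycle_factors E \subset cycle_factors E'.
Proof.
move=> sEE' pE' abE' smE'; apply/subsetP=> P EP; have pE := pgroupS sEE' pE'.
have [PP cEP sPE] := cycle_factorsP _ _ EP.
have orbE' x : x \in supp P -> orbit 'P E' x = supp P.
  move=> Px; apply/eqP; rewrite eq_sym eqEcard -{1}(cycle_factor_orbit pE EP Px) imsetS //=.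
  by rewrite p_cycle_supp //; apply: (forallP smE').
apply/cycle_factorsP; split=> //; last exact: subset_trans sPE (suppS sEE').
apply/centsP=> g' E'g' c Pc; apply/permP=> x; rewrite !permM.
have [Px | nPx] := boolP (x \in supp P).
  have [g Eg eq_gc] := cycle_factor_agree pE EP Pc Px.
  have E'g := subsetP sEE' g Eg.
  have Pgx : g' x \in supp P by rewrite -(orbE' x Px) orbit_perm.
  by rewrite -!eq_gc // (cent_perm _ abE' E'g E'g').
rewrite (suppPn _ _ nPx c) // (suppPn P (g' x) _ c) //.
apply: contra nPx => Pg'x; rewrite -(orbE' _ Pg'x) orbit_sym.
exact: orbit_perm.
Qed.

Lemma cycle_factors_neq0 E : E \in Q -> small E -> cycle_factors E != set0.
Proof.
rewrite inE => /andP[abE ntE] smE; have pE := abelem_pgroup abE.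
have [g Eg ntg] := trivgPn _ ntE.
have [x ngx] : exists x, g x != x.
  apply/existsP; apply: contraR ntg; rewrite negb_exists => /forallP fixg.
  by apply/eqP/permP=> x; rewrite perm1; apply/eqP/negPn/fixg.
pose O := orbit 'P E x; have Ex : x \in supp E by apply/suppP; exists g.
have cardO : #|O| = p by apply: small_orbit.
have actO h : h \in E -> h \in 'N(O | 'P).
  by apply/subsetP/acts_orbit/subsetT.
have OE h y : h \in E -> (h y \in O) = (y \in O) by move=> /actO Nh; apply: (astabs_act y Nh).
pose c := restr_perm O g.
have cE y : y \in O -> c y = g y by move=> Oy; apply: restr_permE (actO g Eg) Oy.
have on_c : perm_on O c by apply: restr_perm_on.
have Ox : x \in O by apply: orbit_refl.
have oc : #[c] = p.
  apply: nt_prime_order => //.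
    by rewrite -morphX ?actO //= ((abelemP _ abE).2 g Eg) // morph1.
  by apply: contraNneq ngx => c1; rewrite -cE // c1 perm1.
have orbcO : porbit c x = O.
  apply/eqP; rewrite eqEcard; apply/andP; split.
    apply/subsetP=> _ /porbitP[i ->]; rewrite permX; elim: i => //= i IHi.
    by rewrite (perm_closed _ on_c).
  have pc : p.-group <[c]> by rewrite /pgroup -orderE oc pnat_id.
  rewrite cardO porbitE; apply: leq_orbit_supp => //.
  by apply/suppP; exists c; rewrite ?cycle_id ?cE.
have suppc : supp <[c]> = O by rewrite -orbcO; apply: p_cycle_suppE; rewrite orbcO.
apply/set0Pn; exists <[c]>%G; apply/cycle_factorsP; split.
- apply/p_cycle_subgroupP; exists c => //; apply/existsP; exists x.
  by rewrite orbcO cardO eqxx.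
- rewrite cent_cycle; apply/subsetP=> h Eh; apply/cent1P/permP=> y; rewrite !permM.
  have [Oy | nOy] := boolP (y \in O).
    rewrite !cE ?OE //; exact: cent_perm (abelem_abelian abE) Eg Eh.
  by rewrite (out_perm on_c nOy) (out_perm on_c) // OE.
rewrite suppc; apply/subsetP=> _ /orbitP[h Eh <-]; apply/suppP; exists g => //.
by rewrite /= /aperm (cent_perm _ (abelem_abelian abE)) // (inj_eq perm_inj).
Qed.

End PCycles.

Section Joins.

Variables p n : nat.
Hypothesis p_pr : prime p.
Implicit Types (G H E P : {group 'S_n}) (s t : seq {group 'S_n}) (x y z : 'I_n).

Local Notation PC := (p_cycle_subgroups p n).
Local Notation Q := (elementary_abelian_subgroups p n).
Local Notation QK := (quillen_complex p n).
Local Notation CK := (p_cycle_complex p n).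

Definition join_groups s : {group 'S_n} := <<\bigcup_(E <- s) E>>%G.
Local Notation J := join_groups.
Local Notation key := (fun E : {group 'S_n} => #|E|).

Lemma join_groups_sup s E : E \in s -> E \subset J s.
Proof.
by move=> sE; apply: sub_gen; rewrite (big_rem E) //= subsetUl.
Qed.

Lemma join_groups_subP s (A : {group 'S_n}) :
  reflect {in s, forall E, E \subset A} (J s \subset A).
Proof.
apply: (iffP idP) => [sJA E sE | sA]; first exact: subset_trans (join_groups_sup sE) sJA.
rewrite gen_subG big_seq; elim/big_ind: _ => [|B C|E /sA//]; first exact: sub0set.
by rewrite subUset => ->.
Qed.

Lemma perm_join_groups s t : perm_eq s t -> J s = J t.
Proof. by move=> st; apply: val_inj; rewrite /= (perm_big t). Qed.

Lemma join_groups_cons E s : J (E :: s) = E <*> J s :> {set 'S_n}.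
Proof. by rewrite /J /= big_cons joing_idr. Qed.

Lemma join_groupsS s t : {subset s <= t} -> J s \subset J t.
Proof. by move=> st; apply/join_groups_subP=> E /st/join_groups_sup. Qed.

Lemma supp_join_groups s x : x \in supp (J s) -> exists2 E, E \in s & x \in supp E.
Proof.
move=> /(subsetP (supp_gen_sub _))/suppP[g]; rewrite big_seq.
elim/big_ind: _ => [|B C IHB IHC|E sE Eg ngx]; first by rewrite inE.
  by rewrite inE => /orP[/IHB | /IHC].
by exists E; rewrite //; apply/suppP; exists g.
Qed.

Lemma join_groups_abelem s : {in s, forall E, p.-abelem E} ->
  {in s &, forall E E', E' \subset 'C(E)} -> p.-abelem (J s).
Proof.
elim: s => [|E s IHs] abs cs; first by rewrite /J /= big_nil gen0 abelem1.
have cEs : J s \subset 'C(E).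
  by apply/join_groups_subP=> E' sE'; apply: cs; rewrite ?mem_head // inE sE' orbT.
rewrite join_groups_cons (cprod_abelem p (cprodEY cEs)) abs ?mem_head //= IHs //.
  by move=> E' sE'; apply: abs; rewrite inE sE' orbT.
by move=> E1 E2 sE1 sE2; apply: cs; rewrite inE ?sE1 ?sE2 orbT.
Qed.

Lemma orbit_join_groups s (S : {set 'I_n}) x :
    {in s, forall E g y, g \in E -> y \in S -> g y \in S} ->
  x \in S -> orbit 'P (J s) x \subset S.
Proof.
move=> sS; apply: orbit_gen_sub => g y; rewrite big_seq.
elim/big_ind: _ => [|B C IHB IHC|E sE]; first by rewrite inE.
  by rewrite inE => /orP[/IHB | /IHC].
exact: sS.
Qed.

Definition bounded s := [&& all (mem Q) s, p.-abelem (J s) & small p (J s)].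

Lemma perm_bounded s t : perm_eq s t -> bounded s -> bounded t.
Proof.
by move=> st; rewrite /bounded (perm_all _ st) (perm_join_groups st).
Qed.

Lemma quillen_simplexP s :
  reflect [/\ uniq s, {in s, forall E, E \in Q} &
             {in s &, forall E E', (E \subset E') || (E' \subset E)}]
    (simplex QK s).
Proof.
rewrite /simplex inE; apply: (iffP and3P) => [[Us /subsetP sQ /forall_inP cs] | [Us sQ cs]].
  split=> // [E sE | E E' sE sE']; first by apply: sQ; rewrite inE.
  by apply: (forall_inP (cs E _)); rewrite inE.
split=> //; first by apply/subsetP=> E; rewrite inE => /sQ.
by apply/forall_inP=> E; rewrite inE => sE; apply/forall_inP=> E'; rewrite inE; apply: cs.
Qed.

Lemma p_cycle_simplexP s :
  reflect [/\ uniq s, {in s, forall P, P \in PC} &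
             {in s &, forall P P', P' \subset 'C(P)}]
    (simplex CK s).
Proof.
rewrite /simplex inE abelian_gen.
apply: (iffP and3P) => [[Us /subsetP sPC cs] | [Us sPC cs]].
  split=> // [P sP | P P' sP sP']; first by apply: sPC; rewrite inE.
  apply: subset_trans (subset_trans cs (centS _)); last by apply: bigcup_sup; rewrite inE.
  by apply: bigcup_sup; rewrite inE.
split=> //; first by apply/subsetP=> P; rewrite inE => /sPC.
apply/bigcupsP=> P'; rewrite inE => sP'; rewrite centsC; apply/bigcupsP=> P.
by rewrite inE => sP; rewrite centsC; apply: cs.
Qed.

Lemma quillen_key s : simplex QK s -> uniq (map key s).
Proof.
case/quillen_simplexP=> Us _ cs; rewrite map_inj_in_uniq // => E E' sE sE' eqEE'.
apply/val_inj/eqP; have /orP[sub | sub] := cs E E' sE sE'.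
  by rewrite eqEcard sub /= eqEE'.
by rewrite eq_sym eqEcard sub /= eqEE'.
Qed.

Lemma quillen_simplex_cons E s : simplex QK (E :: s) -> simplex QK s.
Proof.
case/quillen_simplexP=> /= /andP[_ Us] sQ cs; apply/quillen_simplexP; split=> //.
  by move=> E' sE'; apply: sQ; rewrite inE sE' orbT.
by move=> E1 E2 sE1 sE2; apply: cs; rewrite inE ?sE1 ?sE2 orbT.
Qed.

Lemma quillen_card_sub s E E' : simplex QK s -> E \in s -> E' \in s ->
  #|E| <= #|E'| -> E \subset E'.
Proof.
case/quillen_simplexP=> _ _ cs sE sE' leEE'; have /orP[//|sE'E] := cs E E' sE sE'.
suff /eqP eqE : E' :==: E by rewrite -eqE.
by rewrite eqEcard sE'E.
Qed.

Lemma join_groups_max E s : {in s, forall E', E' \subset E} -> J (E :: s) = E.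
Proof.
move=> sE; apply/val_inj/eqP; rewrite eqEsubset /= join_groups_sup ?mem_head // andbT.
by apply/join_groups_subP=> E'; rewrite inE => /orP[/eqP-> | /sE].
Qed.

Lemma quillen_sorted_flag s : simplex QK s -> key_sorted key s -> flag J s = s.
Proof.
elim: s => //= E s IHs Ks Ss; have Ss' : key_sorted key s by exact: path_sorted Ss.
rewrite IHs ?(quillen_simplex_cons Ks) //.
congr (_ :: _); apply: join_groups_max => E' sE'.
apply: (quillen_card_sub Ks); rewrite ?mem_head ?inE ?sE' ?orbT // ltnW //.
have tr : transitive gtn by move=> a b c /= ba cb; apply: ltn_trans ba.
by have /allP/(_ (key E') (map_f key sE')) := order_path_min tr Ss.
Qed.

Lemma quillen_unsorted_flag s : simplex QK s -> ~~ key_sorted key s -> ~~ uniq (flag J s).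
Proof.
move=> Ks; apply: contra; elim: s Ks => //= E s IHs Ks /andP[nE Us].
have {IHs}Ss := IHs (quillen_simplex_cons Ks) Us.
rewrite (quillen_sorted_flag (quillen_simplex_cons Ks) Ss) in nE.
case: s Ks Ss {Us} nE => //= E' s Ks Ss nE.
have := Ss; rewrite /key_sorted /= => ->; rewrite andbT ltnNge.
apply: contra nE => leEE'; have sEE' : E \subset E'.
  by apply: (quillen_card_sub Ks) => //; rewrite !inE eqxx ?orbT.
suff -> : J [:: E, E' & s] = E' by apply: mem_head.
have sE' : J (E' :: s) = E'.
  by have := quillen_sorted_flag (quillen_simplex_cons Ks) Ss => -[].
apply/val_inj; rewrite /= -/(gval (J _)) join_groups_cons sE'; exact/joing_idPr.
Qed.

Lemma flag_sub s E : E \in flag J s -> E \subset J s.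
Proof.
elim: s => //= E' s IHs; rewrite inE => /orP[/eqP-> // | /IHs sEs].
by apply: subset_trans sEs (join_groupsS _) => E1 sE1; rewrite inE sE1 orbT.
Qed.

Lemma flag_chain s : {in flag J s &, forall E E', (E \subset E') || (E' \subset E)}.
Proof.
elim: s => //= E s IHs E1 E2; rewrite !inE.
have sub E' : E' \in flag J s -> E' \subset J (E :: s).
  by move=> sE'; apply: flag_sub; rewrite inE sE' orbT.
case/orP=> [/eqP-> | sE1] /orP[/eqP-> | sE2]; rewrite ?subxx ?sub ?orbT //.
exact: IHs.
Qed.

Lemma flag_elementary s : {in s, forall E, E \in Q} -> p.-abelem (J s) ->
  {in flag J s, forall E, E \in Q}.
Proof.
elim: s => //= E s IHs sQ abJ E1; rewrite inE => /orP[/eqP-> | sE1].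
  rewrite inE abJ /=; have := sQ E (mem_head _ _); rewrite inE => /andP[_ ntE].
  apply: contraNneq ntE => J1; rewrite -subG1 -J1 join_groups_sup ?mem_head //.
apply: IHs sE1 => [E2 sE2 |]; first by apply: sQ; rewrite inE sE2 orbT.
by apply: abelemS abJ; apply: join_groupsS => E2 sE2; rewrite inE sE2 orbT.
Qed.

Lemma bounded_flag s : bounded s -> uniq (flag J s) -> simplex QK (flag J s).
Proof.
case/and3P=> /allP sQ abJ _ Us; apply/quillen_simplexP; split=> //.
  exact: flag_elementary.
exact: flag_chain.
Qed.

Lemma p_cycle_abelem P : P \in PC -> p.-abelem P.
Proof. by move/(p_cycle_elementary p_pr); rewrite inE => /andP[]. Qed.

Lemma p_cycle_simplex_cent s P : simplex CK s -> P \in s -> J s \subset 'C(P).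
Proof.
by case/p_cycle_simplexP=> _ _ cs sP; apply/join_groups_subP=> P' sP'; apply: cs.
Qed.

Lemma p_cycle_simplex_bounded s : simplex CK s -> bounded s.
Proof.
move=> Ls; have [Us sPC cs] := p_cycle_simplexP _ Ls; apply/and3P; split.
- by apply/allP=> P /sPC/(p_cycle_elementary p_pr).
- by apply: join_groups_abelem => // P /sPC/p_cycle_abelem.
apply/forallP=> x.
have [/supp_join_groups[P sP Px] | /suppPn fixx] := boolP (x \in supp (J s)).
  rewrite -(p_cycle_supp p_pr (sPC P sP)) subset_leq_card //.
  apply: orbit_sub_perm Px => g y Jg; exact: cent_supp (p_cycle_simplex_cent Ls sP) Jg.
apply: leq_trans (prime_gt0 p_pr); rewrite -(cards1 x) subset_leq_card //.
by apply/subsetP=> _ /orbitP[g /fixx/= gx <-]; rewrite inE /= /aperm gx.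
Qed.

Lemma cycle_factors_join s : simplex CK s -> cycle_factors p (J s) = [set P in s].
Proof.
move=> Ls; have [_ sPC _] := p_cycle_simplexP _ Ls.
apply/setP=> P; rewrite [RHS]inE; apply/cycle_factorsP/idP => [[PP cPJ sPJ] | sP].
  have [x Px] := p_cycle_supp_neq0 p_pr PP.
  have [P' sP' P'x] := supp_join_groups (subsetP sPJ x Px).
  have cPP' : P' \subset 'C(P) by apply: subset_trans (join_groups_sup sP') cPJ.
  by rewrite (commuting_p_cycles_eq p_pr PP (sPC P' sP') cPP' Px P'x).
by rewrite sPC // p_cycle_simplex_cent // suppS ?join_groups_sup.
Qed.

Lemma p_cycle_flag_uniq s : simplex CK s -> uniq (flag J s).
Proof.
elim: s => //= P s IHs Ls; have [/= /andP[nsP Us] sPC cs] := p_cycle_simplexP _ Ls.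
have Ls' : simplex CK s.
  apply/p_cycle_simplexP; split=> // [P1 sP1 | P1 P2 sP1 sP2].
    by apply: sPC; rewrite inE sP1 orbT.
  by apply: cs; rewrite inE ?sP1 ?sP2 orbT.
rewrite IHs // andbT; apply: contra nsP => /flag_sub sub.
have sPJ : P \subset J s by apply: subset_trans sub; rewrite join_groups_sup ?mem_head.
suff : P \in cycle_factors p (J s) by rewrite cycle_factors_join // inE.
apply/cycle_factorsP; split; rewrite ?sPC ?mem_head ?suppS //.
apply/join_groups_subP=> P' sP'; apply: cs; rewrite ?mem_head //.
by rewrite inE sP' orbT.
Qed.

End Joins.

(** * Ranks and dimensions *)

Section Ranks.

Variables p n : nat.
Hypothesis p_pr : prime p.
Implicit Types (G H E P : {group 'S_n}) (s t : seq {group 'S_n}) (x y z : 'I_n).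

Local Notation PC := (p_cycle_subgroups p n).
Local Notation Q := (elementary_abelian_subgroups p n).
Local Notation QK := (quillen_complex p n).
Local Notation CK := (p_cycle_complex p n).
Local Notation J := (@join_groups n).

Lemma abelian_card_orbits E : abelian E ->
  (#|E| <= \prod_(B in orbit 'P E @: setT) #|B|)%N.
Proof.
move=> abE; have [x0 _ | no_x] := pickP (@predT 'I_n); last first.
  have -> : E = 1%G.
    by apply/trivGP/subsetP=> g _; rewrite inE; apply/eqP/permP=> x; have := no_x x.
  by rewrite cards1; apply: prodn_cond_gt0 => B /imsetP[x]; have := no_x x.
set Os := orbit 'P E @: setT.
pose rep (B : {set 'I_n}) := odflt x0 [pick x in B].
pose f (g : 'S_n) := [ffun B : {set 'I_n} => if B \in Os then g (rep B) else x0].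
pose D (B : {set 'I_n}) := if B \in Os then B else [set x0].
have repE x : rep (orbit 'P E x) \in orbit 'P E x.
  by rewrite /rep; case: pickP => //= /(_ x); rewrite orbit_refl.
have inj_f : {in E &, injective f}.
  move=> g h Eg Eh eq_f; apply/permP=> x.
  have /orbitP[d Ed def_x] : x \in orbit 'P E (rep (orbit 'P E x)) by rewrite orbit_sym repE.
  have := congr1 (fun f : {ffun {set 'I_n} -> 'I_n} => f (orbit 'P E x)) eq_f.
  rewrite !ffunE imset_f ?inE // => eq_gh; rewrite -def_x /= /aperm.
  by rewrite (cent_perm _ abE) // eq_gh -(cent_perm _ abE).
rewrite -(card_in_imset inj_f).
have sfD : f @: E \subset (family D : pred {ffun {set 'I_n} -> 'I_n}).
  apply/subsetP=> _ /imsetP[g Eg ->]; apply/familyP=> B; rewrite ffunE /D.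
  case: ifP => [/imsetP[x _ ->] | _]; last by rewrite inE.
  have /orbitP[d Ed <-] := repE x; apply/orbitP.
  by exists (d * g); rewrite ?groupM //= /aperm permM.
apply: leq_trans (subset_leq_card sfD) _.
rewrite card_family foldrE big_map big_enum /= [leqRHS]big_mkcond /=.
by apply: leq_prod => B _; rewrite /D; case: ifP => // _; rewrite cards1.
Qed.

Lemma mul_leq_expn a : (p * a <= p ^ a)%N.
Proof.
have p_gt1 := prime_gt1 p_pr; case: a => [|a]; first by rewrite muln0.
by rewrite expnS leq_pmul2l ?prime_gt0 // ltn_expl.
Qed.

Lemma mul_leq_expn2 a : 1 < a -> (p * (a + (p - 2)) <= p ^ a)%N.
Proof.
have p_gt1 := prime_gt1 p_pr; case: a => [|[|a]] // _.
rewrite expnS leq_pmul2l ?prime_gt0 //; elim: a => [|a IHa]; first by rewrite expn1; lia.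
rewrite expnS; apply: leq_trans (_ : (2 * p ^ a.+1 <= _)%N); last by rewrite leq_mul2r p_gt1 orbT.
have : (0 < p ^ a.+1)%N by rewrite expn_gt0 prime_gt0.
by lia.
Qed.

Lemma rank_bounds E : p.-group E -> abelian E ->
  (p * logn p #|E| <= n)%N /\ (~~ small p E -> (p * (logn p #|E| + (p - 2)) <= n)%N).
Proof.
move=> pE abE; set Os := orbit 'P E @: setT; pose a (B : {set 'I_n}) := logn p #|B|.
have cardB B : B \in Os -> #|B| = (p ^ a B)%N.
  case/imsetP=> x _ ->; have [b card_b] := orbit_p_group x pE.
  by rewrite /a card_b pfactorK.
have sumB : n = (\sum_(B in Os) #|B|)%N.
  rewrite -(card_partition (orbit_partition _)) ?cardsT ?card_ord //.
  by apply/actsP=> g _ x; rewrite !inE.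
have le_r : (logn p #|E| <= \sum_(B in Os) a B)%N.
  rewrite -(leq_exp2l _ _ (prime_gt1 p_pr)) -card_pgroup // expn_sum.
  by rewrite -(eq_bigr _ cardB) abelian_card_orbits.
split=> [|/forallPn[x]].
  apply: leq_trans (_ : p * \sum_(B in Os) a B <= n)%N; first by rewrite leq_mul2l le_r orbT.
  rewrite [leqRHS]sumB big_distrr; apply: leq_sum => B OB.
  rewrite (cardB B OB); exact: mul_leq_expn.
rewrite -ltnNge; set B0 := orbit 'P E x => lt_p_B0.
have OB0 : B0 \in Os by apply: imset_f.
have a_gt1 : 1 < a B0.
  by move: lt_p_B0; rewrite (cardB _ OB0) -{1}[p]expn1 ltn_exp2l // prime_gt1.
rewrite (bigD1 B0) //= in le_r; rewrite [X in _ = X](bigD1 B0) //= in sumB.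
have := mul_leq_expn2 a_gt1; rewrite -cardB // => le_B0.
have : (p * \sum_(B in Os | B != B0) a B <= \sum_(B in Os | B != B0) #|B|)%N.
  rewrite big_distrr; apply: leq_sum => B /andP[OB _]; rewrite (cardB B OB); exact: mul_leq_expn.
move: le_r le_B0 sumB; move: (\sum_(B in Os | B != B0) a B)%N => u.
move: (\sum_(B in Os | B != B0) #|B|)%N => v le_r le_B0 sumB le_uv.
rewrite [leqRHS]sumB; apply: leq_trans (leq_add le_B0 le_uv); rewrite -mulnDr leq_mul2l.
by apply/orP; right; rewrite addnAC leq_add2r.
Qed.

Lemma quillen_top s : simplex QK s -> s != [::] ->
  exists2 E, E \in s & {in s, forall E', E' \subset E} /\ (size s <= logn p #|E|)%N.
Proof.
move=> Ks; case: s Ks => // E0 s0; set s := E0 :: s0 => Ks _.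
have [Us sQ cs] := quillen_simplexP _ _ Ks.
have sE0 : E0 \in s by apply: mem_head.
case: (arg_maxnP (P := mem s) (fun E : {group 'S_n} => #|E|) sE0) => E sE maxE.
have topE : {in s, forall E', E' \subset E}.
  by move=> E' sE'; apply: (quillen_card_sub Ks) => //; apply: maxE.
exists E => //; split=> //.
have pQ E' : E' \in s -> p.-group E'.
  by move/sQ; rewrite inE => /andP[/abelem_pgroup].
rewrite -(size_iota 1 (logn p #|E|)) -(size_map (fun E' : {group 'S_n} => logn p #|E'|) s).
apply: uniq_leq_size.
  rewrite map_inj_in_uniq // => E1 E2 sE1 sE2 eq12.
  have eq_card : #|E1| = #|E2| by rewrite (card_pgroup (pQ E1 sE1)) (card_pgroup (pQ E2 sE2)) eq12.
  by apply/val_inj/eqP; rewrite eqEsubset !(quillen_card_sub Ks) ?eq_card.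
move=> _ /mapP[E' sE' ->]; rewrite mem_iota add1n ltnS.
rewrite dvdn_leq_log ?cardG_gt0 ?cardSg ?topE // andbT lt0n.
have := sQ E' sE'; rewrite inE => /andP[_]; apply: contraNneq => r0.
by rewrite trivg_card1 (card_pgroup (pQ _ sE')) r0.
Qed.

Lemma quillen_simplex_small s k : (n %/ p + 3 <= k + p)%N -> (k <= size s)%N ->
  simplex QK s -> {in s, forall E, small p E}.
Proof.
move=> le_k le_ks Ks E sE; have s0 : s != [::] by case: s sE {Ks le_ks}.
have [_ sQ _] := quillen_simplexP _ _ Ks.
have [E0 sE0 [topE0 le_r]] := quillen_top Ks s0.
apply: smallS (topE0 E sE) _; have := sQ E0 sE0; rewrite inE => /andP[abE0 _].
have [_ bound] := rank_bounds (abelem_pgroup abE0) (abelem_abelian abE0).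
apply: contraT => /bound; rewrite mulnC -leq_divRL ?prime_gt0 // => le_n.
have := prime_gt1 p_pr; move: le_k le_ks le_r le_n.
move: (n %/ p) (size s) (logn p _) => m ss r; lia.
Qed.

Lemma quillen_size s : simplex QK s -> (size s <= n %/ p)%N.
Proof.
move=> Ks; have [-> // | s0] := eqVneq s [::].
have [E sE [_ le_r]] := quillen_top Ks s0; apply: leq_trans le_r _.
have [_ sQ _] := quillen_simplexP _ _ Ks.
have := sQ E sE; rewrite inE => /andP[abE _].
have [bound _] := rank_bounds (abelem_pgroup abE) (abelem_abelian abE).
by rewrite leq_divRL ?prime_gt0 // mulnC.
Qed.

Lemma p_cycle_size s : simplex CK s -> (size s <= n %/ p)%N.
Proof.
move=> Ls; rewrite -(size_flag J); apply: quillen_size.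
apply: bounded_flag; first exact: (p_cycle_simplex_bounded p_pr Ls).
exact: (p_cycle_flag_uniq p_pr Ls).
Qed.

Lemma p_cycle_on (S : {set 'I_n}) : #|S| = p ->
  exists2 P, P \in PC & supp P = S.
Proof.
move=> cardS; have gS : group_set [set u : 'S_n | perm_on S u].
  by apply/group_setP; split=> [|u v]; rewrite !inE ?perm_on1 //; apply: perm_onM.
have [|c] := @Cauchy _ p (Group gS) p_pr.
  by rewrite cardsE card_perm cardS dvdn_fact // prime_gt0 //=.
rewrite inE => on_c oc; have [x ncx] : exists x, c x != x.
  apply/existsP; apply: contraLR (prime_gt1 p_pr); rewrite negb_exists => /forallP fixc.
  rewrite -leqNgt -oc (_ : c = 1) ?order1 //.
  by apply/permP=> x; rewrite perm1; apply/eqP/negPn/fixc.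
have sub : porbit c x \subset S.
  apply/subsetP=> _ /porbitP[i ->]; rewrite permX; elim: i => [|i IHi] /=.
    by apply: contraR ncx => /(out_perm on_c)->.
  by rewrite (perm_closed _ on_c).
have orbS : porbit c x = S.
  apply/eqP; rewrite eqEcard sub cardS /=.
  have pc : p.-group <[c]> by rewrite /pgroup -orderE oc pnat_id.
  rewrite porbitE; apply: leq_orbit_supp => //.
  by apply/suppP; exists c; rewrite ?cycle_id.
have on_cx : perm_on (porbit c x) c by rewrite orbS.
exists <[c]>%G; last by rewrite /= (p_cycle_suppE p_pr _ on_cx) orbS.
by apply/p_cycle_subgroupP; exists c => //; apply/existsP; exists x; rewrite orbS cardS eqxx.
Qed.

Lemma card_block i : (i < n %/ p)%N -> #|[set x : 'I_n | x %/ p == i]| = p.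
Proof.
move=> lt_i; have p_gt0 := prime_gt0 p_pr.
have lt_n (j : 'I_p) : (i * p + j < n)%N.
  apply: leq_trans (_ : i.+1 * p <= n)%N; first by rewrite mulSn addnC -addSn leq_add2r.
  by rewrite -leq_divRL.
have inj_f : injective (fun j => Ordinal (lt_n j)).
  by move=> j1 j2 /(congr1 val) /= /addnI /val_inj.
rewrite -[RHS]card_ord -(card_imset _ inj_f); apply: eq_card => x; rewrite inE.
apply/eqP/imsetP => [def_i | [j _ ->]]; last first.
  by rewrite /= divnMDl // divn_small ?addn0.
exists (Ordinal (ltn_pmod x p_gt0)) => //; apply: val_inj.
by rewrite /= -def_i -divn_eq.
Qed.

Lemma p_cycle_simplex_exists : exists2 s, simplex CK s & size s = n %/ p.
Proof.
pose B (i : 'I_(n %/ p)) := [set x : 'I_n | x %/ p == i].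
have [P PB] : exists P : 'I_(n %/ p) -> {group 'S_n},
    forall i, P i \in PC /\ supp (P i) = B i.
  apply: (@fin_all_exists _ (fun=> {group 'S_n}) (fun i P => P \in PC /\ supp P = B i)) => i.
  by have [P PP suppP] := p_cycle_on (card_block (ltn_ord i)); exists P.
have suppPB i x : (x \in supp (P i)) = (x %/ p == i) by have [_ ->] := PB i; rewrite inE.
exists [seq P i | i <- enum 'I_(n %/ p)]; last by rewrite size_map size_enum_ord.
apply/p_cycle_simplexP; split.
- rewrite map_inj_uniq ?enum_uniq // => i j eqPij; have [PPi _] := PB i.
  have [x Px] := p_cycle_supp_neq0 p_pr PPi.
  have /eqP di : x %/ p == i by rewrite -suppPB.
  have /eqP dj : x %/ p == j by rewrite -suppPB -eqPij.
  by apply: val_inj; rewrite /= -di dj.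
- by move=> _ /mapP[i _ ->]; have [] := PB i.
move=> _ _ /mapP[i _ ->] /mapP[j _ ->]; have [<- | neq_ij] := eqVneq i j.
  by have [/(p_cycle_abelian (n := n))] := PB i.
apply/centsP=> c Pjc d Pid; apply/permP=> x; rewrite !permM.
have fix_perm k e y : e \in P k -> y %/ p != k -> e y = y.
  by move=> Pke; rewrite -suppPB => /suppPn/(_ e Pke).
have stay k e y : e \in P k -> y %/ p = k -> e y %/ p = k.
  move=> Pke /eqP; rewrite -suppPB => Pky; apply/eqP; rewrite -suppPB.
  by have [PPk _] := PB k; apply: cent_supp (p_cycle_abelian PPk) Pke Pky.
have [xi | nxi] := eqVneq (x %/ p) i.
  have njx : x %/ p != j by rewrite xi.
  by rewrite (fix_perm j c x) // (fix_perm j c) // (stay i).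
rewrite [d x](fix_perm i) //; have [xj | nxj] := eqVneq (x %/ p) j.
  by rewrite (fix_perm i d) // (stay j) // eq_sym.
by rewrite (fix_perm j c) // (fix_perm i d).
Qed.

Lemma dimension_simplex (K : simplicial_complex (@conjG_action 'S_n)) m :
    (forall s, simplex K s -> (size s <= m)%N) ->
    (exists2 s, simplex K s & size s = m) ->
  dimension K = (m%:Z - 1)%R.
Proof.
move=> le_m [s Ks sz_s]; rewrite /dimension; congr (Posz _ - 1)%R.
apply/eqP; rewrite eqn_leq; apply/andP; split.
  apply/bigmax_leqP=> A KA; rewrite cardE; apply: le_m.
  rewrite /simplex enum_uniq (_ : [set x in enum A] = A) //.
  by apply/setP=> x; rewrite inE mem_enum.
case/andP: Ks => Us Ks; rewrite -sz_s -(card_uniqP Us) -[#|s|]cardsE.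
exact: (leq_bigmax_cond (F := fun A : {set {group 'S_n}} => #|A|)).
Qed.

Lemma dimension_complexes :
  dimension QK = ((n %/ p)%N%:Z - 1)%R /\ dimension CK = ((n %/ p)%N%:Z - 1)%R.
Proof.
have [s Ls sz_s] := p_cycle_simplex_exists.
split; apply: dimension_simplex.
- exact: quillen_size.
- exists (flag J s); last by rewrite size_flag.
  apply: bounded_flag; first exact: (p_cycle_simplex_bounded p_pr Ls).
  exact: (p_cycle_flag_uniq p_pr Ls).
- exact: p_cycle_size.
by exists s.
Qed.


End Ranks.

(** * The homology isomorphism *)

Section Averaging.

Variables (F : numFieldType) (p n : nat).
Hypothesis p_pr : prime p.
Implicit Types (G H E P : {group 'S_n}) (s t : seq {group 'S_n}) (x y z : 'I_n).

Local Notation PC := (p_cycle_subgroups p n).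
Local Notation Q := (elementary_abelian_subgroups p n).
Local Notation QK := (quillen_complex p n).
Local Notation CK := (p_cycle_complex p n).
Local Notation J := (@join_groups n).
Local Notation factors := (@cycle_factors p n).

Definition average E P : F :=
  if factors E == set0 then (P == E)%:R%R
  else ((P \in factors E)%:R / #|factors E|%:R)%R.

Lemma sum_average E : (\sum_P average E P = 1)%R.
Proof.
rewrite /average; have [_ | ntE] := eqVneq (factors E) set0.
  by rewrite (bigD1 E) //= eqxx big1 ?addr0 // => P /negPf->.
rewrite -mulr_suml -natr_sum.
have -> : (\sum_P (P \in factors E) = #|factors E|)%N.
  by rewrite -sum1_card [RHS]big_mkcond; apply: eq_bigr => P _; case: (P \in _).
by rewrite divff // pnatr_eq0 cards_eq0.
Qed.

Lemma suppJ (A : {set 'S_n}) (a : 'S_n) x : (a x \in supp (A :^ a)) = (x \in supp A).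
Proof.
apply/suppP/suppP => [[_ /imsetP[g Ag ->]] | [g Ag ngx]].
  by rewrite permJ (inj_eq perm_inj); exists g.
by exists (g ^ a); rewrite ?memJ_conjg // permJ (inj_eq perm_inj).
Qed.

Lemma cycle_factorsJ E P a : P \in factors E -> (P :^ a)%G \in factors (E :^ a)%G.
Proof.
case/cycle_factorsP=> PP cEP sPE; apply/cycle_factorsP; split.
- have /p_cycle_subgroupP[c cc ->] := PP; apply/p_cycle_subgroupP.
  exists (c ^ a); first exact: is_p_cycleJ.
  by apply: val_inj; rewrite /= cycleJ.
- by rewrite /= centJ conjSg.
apply/subsetP=> y; rewrite -[y](permKV a) !suppJ; exact: (subsetP sPE).
Qed.

Lemma mem_cycle_factorsJ E P a :
  ((P :^ a)%G \in factors (E :^ a)%G) = (P \in factors E).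
Proof.
apply/idP/idP => [/(cycle_factorsJ a^-1) | ]; last exact: cycle_factorsJ.
have JK G : ((G :^ a) :^ a^-1)%G = G by apply: val_inj; rewrite /= conjsgK.
by rewrite !JK.
Qed.

Lemma average_act E P a :
  average (conjG_action _ E a) (conjG_action _ P a) = average E P.
Proof.
rewrite /= /average.
have injJ : injective (fun G : {group 'S_n} => (G :^ a)%G).
  by move=> G1 G2 /(congr1 val)/= /conjsg_inj /val_inj.
have -> : factors (E :^ a)%G = [set (G :^ a)%G | G in factors E].
  apply/setP=> G; apply/idP/imsetP => [EG | [G' EG' ->]]; last exact: cycle_factorsJ.
  exists (G :^ a^-1)%G; last by apply: val_inj; rewrite /= conjsgKV.
  rewrite -(mem_cycle_factorsJ _ _ a) (_ : ((G :^ a^-1) :^ a)%G = G) //.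
  by apply: val_inj; rewrite /= conjsgKV.
by rewrite imset_eq0 card_imset // (mem_imset _ _ injJ) (inj_eq injJ).
Qed.

Lemma average_factor E P : E \in Q -> small p E -> average E P != 0%R -> P \in factors E.
Proof.
move=> QE smE; rewrite /average (negPf (cycle_factors_neq0 p_pr QE smE)).
by case: (P \in _); rewrite // mul0r eqxx.
Qed.

Section Carriers.

Variable k : nat.
Hypothesis le_k : (n %/ p + 3 <= k + p)%N.

Lemma quillen_carried s t : (k <= size s)%N -> simplex QK s ->
  carried average s t -> uniq t -> simplex CK t.
Proof.
move=> le_ks Ks At Ut; have sm := quillen_simplex_small p_pr le_k le_ks Ks.
have [_ sQ cs] := quillen_simplexP _ _ Ks.
have tfac P : P \in t -> exists2 E, E \in s & P \in factors E.
  move=> /At[E sE nz]; exists E => //; apply: average_factor nz; [exact: sQ | exact: sm].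
apply/p_cycle_simplexP; split=> // [P /tfac[E _ /cycle_factorsP[]//] | P P' tP tP'].
have [E sE EP] := tfac P tP; have [E' sE' E'P'] := tfac P' tP'.
have abQ E1 : E1 \in s -> p.-abelem E1 by move/sQ; rewrite inE => /andP[].
have sub E1 E2 : E1 \in s -> E2 \in s -> E1 \subset E2 -> factors E1 \subset factors E2.
  move=> sE1 sE2 s12; apply: (cycle_factorsS p_pr) => //; last exact: sm.
    exact: abelem_pgroup (abQ _ sE2).
  exact: abelem_abelian (abQ _ sE2).
have /orP[s12 | s21] := cs E E' sE sE'.
  apply: (cycle_factors_cent p_pr (abelem_pgroup (abQ E' sE'))) => //.
  exact: (subsetP (sub _ _ sE sE' s12)).
apply: (cycle_factors_cent p_pr (abelem_pgroup (abQ E sE))) => //.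
exact: (subsetP (sub _ _ sE' sE s21)).
Qed.

Lemma quillen_prism_carried s t : (k <= size s)%N -> simplex QK s ->
    (forall E, E \in t -> E \in s \/ exists2 E', E' \in s & average E' E != 0%R) ->
  bounded p t.
Proof.
move=> le_ks Ks At; have sm := quillen_simplex_small p_pr le_k le_ks Ks.
have [_ sQ cs] := quillen_simplexP _ _ Ks.
have [s0 | s0] := eqVneq s [::].
  have -> : t = [::]; last by apply: p_cycle_simplex_bounded => //; apply/p_cycle_simplexP.
  case: t At => // E t /(_ E (mem_head _ _)); rewrite s0 => -[|[E']] //.
have [E0 sE0 [topE0 _]] := quillen_top Ks s0.
have abQ E1 : E1 \in Q -> p.-abelem E1 by rewrite inE => /andP[].
have [abE0 smE0] := (abQ _ (sQ _ sE0), sm _ sE0).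
have [pE0 cE0] := (abelem_pgroup abE0, abelem_abelian abE0).
have {}At E : E \in t -> E \in s \/ E \in factors E0.
  case/At=> [|[E' sE' /(average_factor (sQ _ sE') (sm _ sE')) E'E]]; first by left.
  by right; apply: (subsetP (cycle_factorsS p_pr (topE0 _ sE') _ _ _)) E'E.
have tQ E : E \in t -> E \in Q.
  by case/At=> [/sQ // | /cycle_factorsP[PE _ _]]; apply: p_cycle_elementary.
have {}At E : E \in t -> E \subset E0 \/ E \in factors E0.
  by case/At=> [/topE0|]; [left | right].
apply/and3P; split; first by apply/allP.
  apply: join_groups_abelem => [E /tQ/abQ // | E E' /At[sE | fE] /At[sE' | fE']].
  - exact: subset_trans sE' (subset_trans cE0 (centS sE)).
  - rewrite centsC; have [_ c0E' _] := cycle_factorsP _ _ _ fE'; exact: subset_trans sE c0E'.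
  - have [_ c0E _] := cycle_factorsP _ _ _ fE; exact: subset_trans sE' c0E.
  exact: (cycle_factors_cent p_pr pE0).
apply/forallP=> x; apply: leq_trans (forallP smE0 x).
apply/subset_leq_card/orbit_join_groups; last exact: orbit_refl.
move=> E /At[sE | fE] g y Eg Oy.
  have E0g := subsetP sE g Eg; have /orbitP[h E0h <-] := Oy; apply/orbitP.
  by exists (h * g); rewrite ?groupM //= /aperm permM.
have [Ey | /suppPn/(_ g Eg)-> //] := boolP (y \in supp E).
have := cycle_factor_orbit p_pr pE0 fE Ey; rewrite (orbit_eqP Oy) => ->.
have [PE _ _] := cycle_factorsP _ _ _ fE.
exact: cent_supp (p_cycle_abelian PE) Eg Ey.
Qed.

End Carriers.

Lemma average_flag (c : seq {group 'S_n} -> F) s :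
    (forall t, ~~ uniq t -> c t = 0%R) -> simplex CK s ->
  tens average c (flag J s) = ((size s)`!%:R^-1 * c s)%R.
Proof.
elim: s c => [|P s IHs] c c0 Ls; first by rewrite /= fact0 invr1 mul1r.
have [/= /andP[nsP Us] sPC cs] := p_cycle_simplexP _ _ Ls.
have Ls' : simplex CK s.
  apply/p_cycle_simplexP; split=> // [P1 sP1 | P1 P2 sP1 sP2].
    by apply: sPC; rewrite inE sP1 orbT.
  by apply: cs; rewrite inE ?sP1 ?sP2 orbT.
have facJ : factors (J (P :: s)) = [set P' in P :: s] by apply: cycle_factors_join.
transitivity (\sum_P' average (J (P :: s)) P' * ((size s)`!%:R^-1 * c (P' :: s)))%R.
  apply: eq_bigr => P' _; rewrite IHs // => t nUt.
  by apply: c0; rewrite /= (negPf nUt) andbF.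
rewrite (bigD1 P) //= big1 ?addr0 => [|P' neP].
  have ne0 : [set P' in P :: s] != set0 by apply/set0Pn; exists P; rewrite inE mem_head.
  rewrite /average facJ (negPf ne0) inE mem_head cardsE (card_uniqP _) /=; last exact/andP.
  by rewrite mulrA div1r factS natrM invfM.
have [sP' | nsP'] := boolP (P' \in s); first by rewrite c0 ?mulr0 //= sP'.
have ne0 : [set P' in P :: s] != set0 by apply/set0Pn; exists P; rewrite inE mem_head.
by rewrite /average facJ (negPf ne0) !inE (negPf neP) (negPf nsP') !mul0r.
Qed.

Lemma quillen_p_cycle_homology k : (n %/ p + 3 <= k + p)%N ->
  mx_rsim (section_repr (boundaries_module F QK k) (cycles_module F QK k))
          (section_repr (boundaries_module F CK k) (cycles_module F CK k)).
Proof.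
move=> le_k.
apply: (@homology_rsim F _ _ _ QK CK average J (fun E => #|E|)
                         (@bounded p n) k (k`!%:R^-1)%R).
- exact: sum_average.
- by move=> E P a; apply: average_act.
- exact: perm_join_groups.
- exact: perm_bounded.
- exact: quillen_key.
- exact: quillen_sorted_flag.
- exact: quillen_unsorted_flag.
- exact: bounded_flag.
- by move=> s; apply: p_cycle_simplex_bounded.
- exact: quillen_carried.
- exact: quillen_prism_carried.
- by rewrite invr_eq0 pnatr_eq0 -lt0n fact_gt0.
move=> c s <- Ls; apply: average_flag => // t; exact: alts_nonuniq.
Qed.

End Averaging.

Local Open Scope ring_scope.

Theorem theorem3p2 (R : realType) (p n : nat) (p_pr : prime p) (n_gt0 : (0 < n)%N) :
  let t : int := (n %/ p)%N%:Z - 1 in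
  (dimension (quillen_complex p n) = t /\ dimension (p_cycle_complex p n) = t) /\
  (forall j : int, t - (p%:Z - 3) <= j ->
     mx_rsim (reduced_homology R[i] (quillen_complex p n) j)
             (reduced_homology R[i] (p_cycle_complex p n) j)).
Proof.
move=> t; split=> [|j]; first exact: dimension_complexes.
rewrite /reduced_homology; case def_k: (j + 1) => [k | m] le_j; last exact: mx_rsim_refl.
apply: (quillen_p_cycle_homology R[i] p_pr).
by move: le_j def_k; rewrite /t; move: (n %/ p)%N => m; lia.
Qed.
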